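(* Let $p$ be a prime number, $F$ an algebraically closed field of characteristic $p$, $X$ an indeterminate over $F$, $D_n=F[X^{\frac{1}{p^n}},X^{-\frac{1}{p^n}}]$ for each $n\in\mathbb{N}_0$ and $D=\bigcup_{n\in\mathbb{N}_0}D_n$. Let $P_\alpha=\bigcup_{n\in\mathbb{N}_0}(X^{\frac{1}{p^n}}-\alpha^{\frac{1}{p^n}})D_n$ for each nonzero $\alpha\in F$. Then the following statements hold. (1) $\mathrm{Max}(D)=\{P_\alpha\mid 0\neq\alpha\in F\}$. (2) $D_{P_\alpha}$ is a rank one nondiscrete valuation domain for each nonzero $\alpha\in F$. (3) $D/P_\alpha\cong F$ for each nonzero $\alpha\in F$. (4) $\mathrm{ht}(P_\alpha[[Y]]/P_\alpha D[[Y]])\ge 2^{\aleph_1}$ for each nonzero $\alpha\in F$, where $Y$ is an indeterminate over $D$.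
   Context: $\mathbb{N}_0$ is the set of nonnegative integers. The elements $X^{1/p^n}$ are compatible roots of $X$, i.e. $(X^{1/p^{n+1}})^p=X^{1/p^n}$, so $D_n\subsetneq D_{n+1}$. For $\alpha\in F$, $\alpha^{1/p^n}$ is the unique $p^n$-th root of $\alpha$ in $F$. $\mathrm{Max}(D)$ is the set of maximal ideals of $D$. $D[[Y]]$ is the power series ring over $D$; for an ideal $I$ of $D$, $I[[Y]]=\{\sum_{i\ge0}a_iY^i\mid a_i\in I\text{ for all }i\}$, which contains $ID[[Y]]$ and is prime in $D[[Y]]$ when $I$ is prime; $P_\alpha[[Y]]/P_\alpha D[[Y]]$ is regarded as a prime ideal of $D[[Y]]/P_\alpha D[[Y]]$. The length of a chain $\mathcal{C}$ of prime ideals (a nonempty totally ordered set of primes) is $|\mathcal{C}|-1$; for a prime $P$ of a ring $A$ and a cardinal $\alpha$, $\mathrm{ht}P\ge\alpha$ means that $A_P$ has a chain of prime ideals of length $\ge\alpha$. *)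

(* Defs.v *)
From HB Require Import structures.
From mathcomp Require Import all_boot all_order all_algebra.
From mathcomp Require Import generic_quotient ring_quotient.
From mathcomp Require Import boolp classical_sets functions cardinality.
From mathcomp Require Import ring.

Set Implicit Arguments.
Unset Strict Implicit.
Unset Printing Implicit Defensive.

Import GRing.Theory.

Local Open Scope classical_set_scope.
Local Open Scope card_scope.
Local Open Scope ring_scope.
Local Open Scope quotient_scope.

(* [idealr R] and [prime_idealr R] are MathComp's proper ideals and (proper)
   prime ideals; [[set` I]] is the underlying set of [I]. *)

Definition Spec (R : comNzRingType) : set (set R) :=
  [set Q | exists I : prime_idealr R, Q = [set` I]].

Definition Max (R : comNzRingType) : set (set R) :=
  [set M | exists2 I : idealr R, M = [set` I] &
           forall J : idealr R, M `<=` [set` J] -> [set` J] = M].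

Arguments Spec : clear implicits.
Arguments Max : clear implicits.

Definition ideal_gen (R : comNzRingType) (S : set R) : set R :=
  [set z | exists n (a s : 'I_n -> R),
           (forall i, S (s i)) /\ z = \sum_(i < n) a i * s i].

(* A cardinal is given by a set [k] (over any type) of that cardinality. *)

Definition prime_chain (R : comNzRingType) (C : set (set R)) : Prop :=
  C `<=` Spec R /\ total_on C subset.

(* |C| - 1 >= k; in particular C is nonempty. *)
Definition length_ge (T U : Type) (C : set T) (k : set U) : Prop :=
  exists2 c, C c & k #<= C `\ c.

Definition dim_ge (U : Type) (R : comNzRingType) (k : set U) : Prop :=
  exists2 C : set (set R), prime_chain C & length_ge C k.

(* R_P, made of the classes of pairs (a, s) with s outside P, for the relation
   (a, s) ~ (b, t) iff u (a t - b s) = 0 for some u outside P. *)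

Section Localization.
Variables (R : comNzRingType) (P : prime_idealr R).
Local Notation I := (P : {pred R}).

Definition loc_pair : Type := (R * {s : R | s \notin I})%type.

Definition loc_equiv (x y : loc_pair) : bool :=
  `[< exists2 u : R, u \notin I & u * (x.1 * val y.2 - y.1 * val x.2) = 0 >].

Let notinM u v : u \notin I -> v \notin I -> u * v \notin I.
Proof. by move=> hu hv; rewrite prime_idealrM negb_or hu. Qed.

Let notin1 : 1 \notin I. Proof. by rewrite idealr1. Qed.

Fact loc_equiv_is_equiv : equiv_class_of loc_equiv.
Proof.
split=> [x|x y|y x z].
- by apply/asboolP; exists 1 => //; rewrite subrr mulr0.
- by apply/asboolP/asboolP=> -[u hu e]; exists u => //;
    rewrite -opprB mulrN e oppr0.
- move=> /asboolP[u hu e] /asboolP[v hv e']; apply/asboolP.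
  exists (u * v * val y.2); first by rewrite !notinM ?(valP y.2).
  have -> : u * v * val y.2 * (x.1 * val z.2 - z.1 * val x.2) =
    v * val z.2 * (u * (x.1 * val y.2 - y.1 * val x.2)) +
    u * val x.2 * (v * (y.1 * val z.2 - z.1 * val y.2)) by rewrite /=; ring.
  by rewrite e e' !mulr0 addr0.
Qed.

Canonical loc_equiv_equiv := EquivRelPack loc_equiv_is_equiv.
Canonical loc_equiv_encModRel := defaultEncModRel loc_equiv.

Definition localization : Type := {eq_quot loc_equiv}.
HB.instance Definition _ : EqQuotient loc_pair loc_equiv localization :=
  EqQuotient.on localization.
HB.instance Definition _ := Choice.on localization.

Definition lden1 : {s : R | s \notin I} := exist _ 1 notin1.
Definition ldenM (s t : {s : R | s \notin I}) : {s : R | s \notin I} :=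
  exist _ (val s * val t) (notinM (valP s) (valP t)).

Definition lfrac (x : loc_pair) : localization := \pi_localization x.

Definition loc_zero : localization := lfrac (0, lden1).
Definition loc_one : localization := lfrac (1, lden1).
Definition loc_opp (x : localization) : localization :=
  lfrac (- (repr x).1, (repr x).2).
Definition loc_add (x y : localization) : localization :=
  lfrac ((repr x).1 * val (repr y).2 + (repr y).1 * val (repr x).2,
         ldenM (repr x).2 (repr y).2).
Definition loc_mul (x y : localization) : localization :=
  lfrac ((repr x).1 * (repr y).1, ldenM (repr x).2 (repr y).2).

Lemma lfracP (x y : loc_pair) : lfrac x = lfrac y <->
  exists2 u : R, u \notin I & u * (x.1 * val y.2 - y.1 * val x.2) = 0.
Proof.
rewrite /lfrac; split; first by move/eqmodP/asboolP.
by move=> h; apply/eqmodP/asboolP.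
Qed.

Lemma lfracK (x : localization) : lfrac (repr x) = x.
Proof. exact: reprK. Qed.

Lemma lfracN a s : loc_opp (lfrac (a, s)) = lfrac (- a, s).
Proof.
have /lfracP[u hu e] := lfracK (lfrac (a, s)).
apply/lfracP; exists u => //=.
by move: e => /= e; rewrite !mulNr -opprD mulrN e oppr0.
Qed.

Lemma lfracD a s b t : loc_add (lfrac (a, s)) (lfrac (b, t)) =
  lfrac (a * val t + b * val s, ldenM s t).
Proof.
have /lfracP[u hu e] := lfracK (lfrac (a, s)).
have /lfracP[v hv e'] := lfracK (lfrac (b, t)).
apply/lfracP; exists (u * v); first exact: notinM.
move: e e' => /=.
case: (repr _) => a' [s' hs'] /= e; case: (repr _) => b' [t' ht'] /= e'.
case: s e => s hs /= e; case: t e' => t ht /= e'.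
transitivity (v * t' * t * (u * (a' * s - a * s')) +
              u * s' * s * (v * (b' * t - b * t'))); first by rewrite /=; ring.
by move: e e' => /= -> ->; rewrite !mulr0 addr0.
Qed.

Lemma lfracM a s b t : loc_mul (lfrac (a, s)) (lfrac (b, t)) =
  lfrac (a * b, ldenM s t).
Proof.
have /lfracP[u hu e] := lfracK (lfrac (a, s)).
have /lfracP[v hv e'] := lfracK (lfrac (b, t)).
apply/lfracP; exists (u * v); first exact: notinM.
move: e e' => /=.
case: (repr _) => a' [s' hs'] /= e; case: (repr _) => b' [t' ht'] /= e'.
case: s e => s hs /= e; case: t e' => t ht /= e'.
transitivity (v * b' * t * (u * (a' * s - a * s')) +
              u * a * s' * (v * (b' * t - b * t'))); first by rewrite /=; ring.
by move: e e' => /= -> ->; rewrite !mulr0 addr0.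
Qed.

Let lfracW (T : localization -> Prop) :
  (forall a s, T (lfrac (a, s))) -> forall x, T x.
Proof. by move=> h x; rewrite -[x]lfracK; case: (repr x). Qed.

Let lfrac_eq (a b : R) s t : a * val t = b * val s ->
  lfrac (a, s) = lfrac (b, t).
Proof. by move=> e; apply/lfracP; exists 1; rewrite //= e subrr mulr0. Qed.

Fact loc_addA : associative loc_add.
Proof.
elim/lfracW=> a s; elim/lfracW=> b t; elim/lfracW=> c u.
by rewrite !lfracD; apply: lfrac_eq => /=; ring.
Qed.

Fact loc_addC : commutative loc_add.
Proof.
elim/lfracW=> a s; elim/lfracW=> b t.
by rewrite !lfracD; apply: lfrac_eq => /=; ring.
Qed.

Fact loc_add0 : left_id loc_zero loc_add.
Proof. by elim/lfracW=> a s; rewrite lfracD; apply: lfrac_eq => /=; ring. Qed.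

Fact loc_addN : left_inverse loc_zero loc_opp loc_add.
Proof.
by elim/lfracW=> a s; rewrite lfracN lfracD; apply: lfrac_eq => /=; ring.
Qed.

Fact loc_mulA : associative loc_mul.
Proof.
elim/lfracW=> a s; elim/lfracW=> b t; elim/lfracW=> c u.
by rewrite !lfracM; apply: lfrac_eq => /=; ring.
Qed.

Fact loc_mulC : commutative loc_mul.
Proof.
elim/lfracW=> a s; elim/lfracW=> b t.
by rewrite !lfracM; apply: lfrac_eq => /=; ring.
Qed.

Fact loc_mul1 : left_id loc_one loc_mul.
Proof. by elim/lfracW=> a s; rewrite lfracM; apply: lfrac_eq => /=; ring. Qed.

Fact loc_mulDl : left_distributive loc_mul loc_add.
Proof.
elim/lfracW=> a s; elim/lfracW=> b t; elim/lfracW=> c u.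
by rewrite !(lfracM, lfracD); apply: lfrac_eq => /=; ring.
Qed.

Fact loc_one_neq0 : loc_one != loc_zero.
Proof.
apply/eqP => /lfracP[u hu /=]; rewrite mulr1 mul0r subr0 mulr1 => u0.
by rewrite u0 idealr0 in hu.
Qed.

HB.instance Definition _ := GRing.isZmodule.Build localization
  loc_addA loc_addC loc_add0 loc_addN.
HB.instance Definition _ := GRing.Zmodule_isComNzRing.Build localization
  loc_mulA loc_mulC loc_mul1 loc_mulDl loc_one_neq0.

End Localization.

Definition ht_ge (U : Type) (R : comNzRingType) (P : prime_idealr R)
  (k : set U) : Prop := dim_ge (localization P) k.

Definition is_fraction_field (R : comNzRingType) (K : fieldType)
    (i : {rmorphism R -> K}) : Prop :=
  injective i /\ forall z : K, exists a b, i b != 0 /\ z = i a / i b.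

Definition valuation_ring (R : comNzRingType) (K : fieldType)
    (i : {rmorphism R -> K}) : Prop :=
  forall z : K, z != 0 -> range i z \/ range i z^-1.

(* v induces an isomorphism of ordered groups from the value group of R, i.e.
   the quotient of the units of K by the units of R ordered by divisibility,
   onto Z. *)
Definition discrete_value_group (R : comNzRingType) (K : fieldType)
    (i : {rmorphism R -> K}) : Prop :=
  exists v : K -> int,
    [/\ forall y z, y != 0 -> z != 0 -> v (y * z) = v y + v z,
        forall k, exists2 z, z != 0 & v z = k &
        forall z, z != 0 -> (0 <= v z)%R <-> range i z].

(* The rank of a valuation domain is its Krull dimension. *)
Definition rank_one_nondiscrete_valuation_domain (R : comNzRingType) : Prop :=
  exists (K : fieldType) (i : {rmorphism R -> K}),
    [/\ is_fraction_field i, valuation_ring i,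
        dim_ge R `I_1 /\ ~ dim_ge R `I_2 & ~ discrete_value_group i].

Record powser (R : Type) := PowSer { psc : nat -> R }.

Section PowerSeries.
Variable R : comNzRingType.
Implicit Types f g h : powser R.

HB.instance Definition _ := gen_eqMixin (powser R).
HB.instance Definition _ := gen_choiceMixin (powser R).

Definition psC (c : R) : powser R := PowSer (fun n => if n == 0%N then c else 0).
Definition ps_opp f : powser R := PowSer (fun n => - psc f n).
Definition ps_add f g : powser R := PowSer (fun n => psc f n + psc g n).
Definition ps_mul f g : powser R :=
  PowSer (fun n => \sum_(i < n.+1) psc f i * psc g (n - i)).

Lemma powserP f g : (forall n, psc f n = psc g n) -> f = g.
Proof. by case: f g => f [g] /= /funext ->. Qed.

Let tr n f : {poly R} := \poly_(i < n.+1) psc f i.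

Let trE n f i : (i <= n)%N -> (tr n f)`_i = psc f i.
Proof. by move=> le_in; rewrite coef_poly ltnS le_in. Qed.

Let ps_mulE n f g i : (i <= n)%N -> psc (ps_mul f g) i = (tr n f * tr n g)`_i.
Proof.
move=> le_in; rewrite coefM; apply: eq_bigr => j _.
by rewrite !trE // (leq_trans _ le_in) ?leq_subr // -ltnS.
Qed.

Fact ps_addA : associative ps_add.
Proof. by move=> f g h; apply: powserP => n; rewrite /= addrA. Qed.
Fact ps_addC : commutative ps_add.
Proof. by move=> f g; apply: powserP => n; rewrite /= addrC. Qed.
Fact ps_add0 : left_id (psC 0) ps_add.
Proof. by move=> f; apply: powserP => n; rewrite /= if_same add0r. Qed.
Fact ps_addN : left_inverse (psC 0) ps_opp ps_add.
Proof. by move=> f; apply: powserP => n; rewrite /= if_same addNr. Qed.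

Fact ps_mulC : commutative ps_mul.
Proof. by move=> f g; apply: powserP => n; rewrite !(@ps_mulE n) // mulrC. Qed.

Fact ps_mulA : associative ps_mul.
Proof.
move=> f g h; apply: powserP => n.
transitivity (tr n f * (tr n g * tr n h))`_n.
  rewrite coefM; apply: eq_bigr => i _.
  by rewrite trE -1?ltnS // -ps_mulE // leq_subr.
rewrite mulrA coefM; apply: eq_bigr => i _.
by rewrite trE ?leq_subr // -ps_mulE // -ltnS.
Qed.

Fact ps_mul1 : left_id (psC 1) ps_mul.
Proof.
move=> f; apply: powserP => n /=.
rewrite big_ord_recl /= mul1r subn0 big1 ?addr0 // => i _.
by rewrite mul0r.
Qed.

Fact ps_mulDl : left_distributive ps_mul ps_add.
Proof.
move=> f g h; apply: powserP => n /=.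
by rewrite -big_split; apply: eq_bigr => i _; rewrite mulrDl.
Qed.

Fact ps_one_neq0 : psC 1 != psC 0.
Proof. by apply/eqP => -[/(congr1 (@^~ 0%N))/eqP]; rewrite /= oner_eq0. Qed.

HB.instance Definition _ := GRing.isZmodule.Build (powser R)
  ps_addA ps_addC ps_add0 ps_addN.
HB.instance Definition _ := GRing.Zmodule_isComNzRing.Build (powser R)
  ps_mulA ps_mulC ps_mul1 ps_mulDl ps_one_neq0.

(* I[[Y]] *)
Definition ps_ideal (I : set R) : set (powser R) :=
  [set f | forall n, I (psc f n)].

(* I R[[Y]] *)
Definition ps_ext (I : set R) : set (powser R) := ideal_gen (psC @` I).

End PowerSeries.

(* The compatible roots of the indeterminate X = X_0 live in an
   arbitrary field K containing F, e.g. an algebraic closure of F(X). *)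

Record root_tower (p : nat) (F K : fieldType) (iota : {rmorphism F -> K}) :=
  RootTower {
    xroot :> nat -> K;
    xroot_transcendental : ~ algebraicOver iota (xroot 0);
    xrootS : forall n, xroot n.+1 ^+ p = xroot n }.

Section UnionRing.
Variables (p : nat) (F K : fieldType) (iota : {rmorphism F -> K}).
Variable x : root_tower p iota.

(* D_n = F[x_n, 1 / x_n]; every element is f(x_n) / x_n^k. *)
Definition Dn (n : nat) : set K :=
  [set z | exists (f : {poly F}) (k : nat),
           z = (map_poly iota f).[x n] / x n ^+ k].

Definition D_pred : {pred K} := fun z => `[< exists n, Dn n z >].

Lemma xroot_neq0 n : x n != 0.
Proof.
apply/eqP => xn0; apply: (xroot_transcendental (r := x)).
have [p0|p_gt0] := posnP p.
  have exp0 (z : K) k : k = 0%N -> z ^+ k = 1 by move=> ->.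
  rewrite -[x 0](xrootS x) exp0 // -(rmorph1 iota); exact: algebraic_id.
suff -> : x 0 = 0 by exact: algebraic0.
elim: n xn0 => // n IHn xn0; apply: IHn.
by rewrite -xrootS xn0 expr0n gtn_eqF.
Qed.

Lemma DnS n : Dn n `<=` Dn n.+1.
Proof.
move=> z [f [k ->]]; exists (f \Po 'X^p), (p * k)%N.
by rewrite map_comp_poly map_polyXn horner_comp hornerXn exprM xrootS.
Qed.

Lemma Dn_le m n : (m <= n)%N -> Dn m `<=` Dn n.
Proof.
move/subnK => <-; elim: (n - m)%N => [//|d IHd] z /IHd.
by rewrite addSn; exact: DnS.
Qed.

Lemma Dn_subring n : subring_closed (fun z => `[< Dn n z >]).
Proof.
have xk k : x n ^+ k != 0 by rewrite expf_neq0 ?xroot_neq0.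
split.
- by apply/asboolP; exists 1, 0%N; rewrite rmorph1 hornerC expr0 divr1.
- move=> _ _ /asboolP[f [k ->]] /asboolP[g [l ->]]; apply/asboolP.
  exists (f * 'X^l - g * 'X^k), (k + l)%N.
  rewrite rmorphB !rmorphM /= !map_polyXn hornerD hornerN !hornerM !hornerXn.
  by rewrite exprD; field; rewrite !xk.
- move=> _ _ /asboolP[f [k ->]] /asboolP[g [l ->]]; apply/asboolP.
  exists (f * g), (k + l)%N.
  by rewrite rmorphM hornerM exprD; field; rewrite !xk.
Qed.

Fact D_subring : subring_closed D_pred.
Proof.
have up2 y z : y \in D_pred -> z \in D_pred ->
    exists n, `[< Dn n y >] /\ `[< Dn n z >].
  move=> /asboolP[m hy] /asboolP[n hz]; exists (maxn m n).
  by split; apply/asboolP; [apply: Dn_le hy|apply: Dn_le hz];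
    rewrite ?leq_maxl ?leq_maxr.
split.
- by apply/asboolP; exists 0%N; apply/asboolP; have [] := Dn_subring 0.
- move=> y z hy hz; have [n [hy' hz']] := up2 y z hy hz.
  by apply/asboolP; exists n; apply/asboolP; have [_ + _] := Dn_subring n; apply.
- move=> y z hy hz; have [n [hy' hz']] := up2 y z hy hz.
  by apply/asboolP; exists n; apply/asboolP; have [_ _ +] := Dn_subring n; apply.
Qed.

HB.instance Definition _ := GRing.isSubringClosed.Build K D_pred D_subring.

(* D, the union of the D_n, as a subring of K. *)
Record Dring := MkDring { Dval : K; Dval_in : Dval \in D_pred }.

HB.instance Definition _ := [isSub for Dval].
HB.instance Definition _ := [Choice of Dring by <:].
HB.instance Definition _ := [SubChoice_isSubComNzRing of Dring by <:].

(* The p^n-th root of a (unique when F is algebraically closed of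
   characteristic p). *)
Definition proot (n : nat) (a : F) : F :=
  xget 0 [set b : F | b ^+ (p ^ n)%N = a].

(* P_a, the union of the (x_n - a^(1/p^n)) D_n. *)
Definition Pideal (a : F) : set Dring :=
  [set d | exists n, exists2 g, Dn n g & val d = (x n - iota (proot n a)) * g].

End UnionRing.

Arguments Pideal {p F K iota} x a.

(* W has the least uncountable cardinality; then [set: set W] has cardinality
   2^aleph_1. *)
Definition is_aleph1 (W : Type) : Prop :=
  ~ countable [set: W] /\
  forall A : set W, countable A \/ A #= [set: W].

(* Main.v *)
Require Import Defs.
From HB Require Import structures.
From Stdlib Require Inverse_Image.
From mathcomp Require Import all_boot all_order all_algebra.
From mathcomp Require Import generic_quotient ring_quotient.
From mathcomp Require Import boolp classical_sets functions cardinality.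
From mathcomp Require Import filter wochoice.
From mathcomp Require Import ring lra zify.

(* Write t_n = X^(1/p^n) - a^(1/p^n), so that t_(n+1)^p = t_n.  Every nonzero d in D
   is t_n^m u with u outside P_a, which gives a valuation v with v(t_n) = p^-n and
   value group Z[1/p]; evaluation at a identifies D/P_a with F, and (1)-(3) follow.

   For (4), each real r > 0 gives the Gauss valuation
   phi_r(f) = min_i (v(a_i) + r i) on D[[Y]].  Let r_k = p^-(k+1)^3 and let U be a
   nonprincipal ultrafilter on the natural numbers.  For an exponent function n, the
   series f such that phi_(r_k)(f) >= p^-(n(k)+C) for some C and U-almost all k form
   an ideal; it is prime because p >= 2 and U is an ultrafilter.  Unions of totally
   ordered families of such ideals are prime too.  Any c with k^2 <= c(k) <= (k+1)^2
   is attained up to a factor p by the sparse series sum_k t_(c(k)) Y^(p^(k^3)).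
   Such functions, with n below n' when n' - n is unbounded along U, interpolate between
   countable families, so a full binary tree of height omega_1 embeds in them, and
   its 2^aleph_1 branches give pairwise distinct comparable primes. *)

Set Implicit Arguments.
Unset Strict Implicit.
Unset Printing Implicit Defensive.

Import GRing.Theory.

Local Open Scope classical_set_scope.
Local Open Scope card_scope.

(** * Branching in countably saturated orders *)

Definition strict_well_order (T : Type) (lt : T -> T -> Prop) : Prop :=
  [/\ well_founded lt, forall x y z, lt x y -> lt y z -> lt x z &
      forall x y, [\/ lt x y, x = y | lt y x]].

(** The well-ordering principle yields a Boolean relation for which every nonempty subset has a
    unique least element. Subsets of one, two and three elements give reflexivity, antisymmetry with
    totality, and transitivity; the negated converse is then the strict order. *)
Lemma strict_well_orderP (T : Type) : exists lt : T -> T -> Prop, strict_well_order lt.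
Proof.
have [R woR] := well_ordering_principle {classic T}.
have min2 (A : {pred {classic T}}) x : x \in A ->
    exists2 z, z \in A & forall y, y \in A -> R z y.
  by move=> xA; have [|z [[zA zmin] _]] := woR A; [exists x|exists z].
have Rxx : reflexive R.
  move=> x; have [|z /eqP-> /(_ x)] := min2 (pred1 x) x; first exact: eqxx.
  by apply; exact: eqxx.
have Ranti : antisymmetric R.
  move=> x y /andP[Rxy Ryx].
  have [|z [_ zuniq]] := woR (pred2 x y); first by exists x; rewrite inE eqxx.
  rewrite -(zuniq x) ?(zuniq y) //; split; rewrite ?inE ?eqxx ?orbT //.
    by move=> t /pred2P[]->.
  by move=> t /pred2P[]->.
have Rtot x y : R x y \/ R y x.
  have [|z /pred2P[]-> zmin] := min2 (pred2 x y) x; first by rewrite inE eqxx.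
    by left; apply: zmin; rewrite inE eqxx orbT.
  by right; apply: zmin; rewrite inE eqxx.
have Rtrans : transitive R.
  move=> y x z Rxy Ryz.
  have [|t] := min2 (pred3 x y z) x; first by rewrite inE eqxx.
  move=> /or3P[]/eqP-> tmin.
  - by apply: tmin; rewrite inE eqxx !orbT.
  - have Ryx : R y x by apply: tmin; rewrite inE eqxx.
    by rewrite (Ranti x y) // Rxy Ryx.
  - have Rzy : R z y by apply: tmin; rewrite inE eqxx orbT.
    by rewrite -(Ranti y z) // Ryz Rzy.
exists (fun x y => ~ R y x); split.
- move=> x; apply: contrapT => nx.
  have [|z /asboolP nz zmin] :=
      min2 [pred y : {classic T} | `[< ~ Acc (fun x y => ~ R y x) y >]] x.
    exact/asboolP.
  apply: nz; constructor => y nzy; apply: contrapT => ny; apply: nzy.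
  by apply: zmin; apply/asboolP.
- move=> x y z nyx nzy Rzx; have [Rxy|//] := Rtot x y.
  by apply: nzy; apply: Rtrans Rzx Rxy.
- move=> x y; have [Rxy|nRxy] := pselect (R x y); last by constructor 3.
  have [Ryx|nRyx] := pselect (R y x); last by constructor 1.
  by constructor 2; apply: Ranti; rewrite Rxy.
Qed.

(** If some initial segment is uncountable, take the least [w0] with this property. The segment
    below [w0] is equipotent to [W], and pulling the order back along an injection of [W] into it
    makes all segments countable. *)
Lemma aleph1_well_order (W : Type) : is_aleph1 W ->
  exists2 lt : W -> W -> Prop, strict_well_order lt &
    forall w, countable [set v | lt v w].
Proof.
move=> [_ dich]; have [lt [wf trans tri]] := strict_well_orderP W.
have [cnt|ncnt] := pselect (forall w, countable [set v | lt v w]).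
  by exists lt.
have [w0 [unc minw]] : exists w, ~ countable [set v | lt v w] /\
    forall v, lt v w -> countable [set u | lt u v].
  apply: contrapT => no; apply: ncnt => w; elim/(well_founded_ind wf): w => w IH.
  by apply: contrapT => ncw; apply: no; exists w.
have [//|/card_eqPle[_ /card_leP[g]]] := dich [set v | lt v w0].
pose h w := val (g (SigSub (mem_set (I : [set: W] w)))).
have hw0 w : lt (h w) w0 by rewrite /h; case: (g _) => /= v /set_mem.
have hinj v w : h v = h w -> v = w.
  by move=> /val_inj/(@inj _ _ _ g); rewrite !inE => /(_ Logic.I Logic.I)[].
exists (fun v w => lt (h v) (h w)); first split.
- exact: Inverse_Image.wf_inverse_image.
- by move=> x y z; exact: trans.
- move=> x y; case: (tri (h x) (h y)) => [||]; [by constructor 1| |by constructor 3].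
  by move=> /hinj->; constructor 2.
- move=> w; have /countable_injP[e einj] := minw _ (hw0 w).
  apply/countable_injP; exists (e \o h) => u v.
  by rewrite !inE => ltu ltv /einj; rewrite !inE => /(_ ltu ltv)/hinj.
Qed.

(** By transfinite recursion, [c chi w] is chosen above the earlier values at indices in [chi] and
    below the earlier values at indices outside [chi]; saturation supplies it because segments are
    countable. The last clause says that branches agreeing below [w] share their value at [w]. *)
Lemma branching_family (W L : Type) (lt : W -> W -> Prop) (ltL : L -> L -> Prop) :
  strict_well_order lt -> (forall w, countable [set v | lt v w]) ->
  (forall x y z, ltL x y -> ltL y z -> ltL x z) ->
  (forall A B : set L, countable A -> countable B ->
     (forall a b, A a -> B b -> ltL a b) ->
     exists c, (forall a, A a -> ltL a c) /\ (forall b, B b -> ltL c b)) ->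
  exists c : set W -> W -> L,
    (forall chi v w, lt v w -> (chi v -> ltL (c chi v) (c chi w)) /\
                               (~ chi v -> ltL (c chi w) (c chi v))) /\
    forall chi chi' w, (forall v, lt v w -> chi v <-> chi' v) ->
      c chi w = c chi' w.
Proof.
move=> [wf trans tri] cnt transL sat.
have [l0 _] : exists l : L, True by have [//|//|//|c] := sat set0 set0; exists c.
pose body (chi : set W) w (rec : forall v, lt v w -> L) : L :=
  @xget {classic L} l0 [set l | forall v (h : lt v w),
    (chi v -> ltL (rec v h) l) /\ (~ chi v -> ltL l (rec v h))].
pose c chi := Fix wf (fun=> L) (body chi).
have cE chi w : c chi w = @xget {classic L} l0 [set l | forall v, lt v w ->
    (chi v -> ltL (c chi v) l) /\ (~ chi v -> ltL l (c chi v))].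
  rewrite {1}/c Fix_eq //.
  move=> u f g fg; congr (@xget {classic L} l0); apply/funext => l; apply/propext.
  by split => H v h; [rewrite -fg|rewrite fg]; exact: H.
exists c; split=> [chi v w|chi chi' w].
- elim/(well_founded_ind wf): w v => w IH.
  suff : [set l | forall v, lt v w ->
      (chi v -> ltL (c chi v) l) /\ (~ chi v -> ltL l (c chi v))] (c chi w).
    by move=> H v; exact: H.
  rewrite cE; apply: xgetPex.
  have cntc (P : set W) : countable (c chi @` [set v | lt v w /\ P v]).
    by apply: sub_countable (card_image_le _ _) _;
       apply: sub_countable (cnt w); apply: subset_card_le => v [].
  (* A value at an index in [chi] lies below one at an index outside [chi]: the later of the two
     values was placed on the correct side of the earlier one. *)
  have [|l [lA lB]] := sat _ _ (cntc chi) (cntc (~` chi)).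
    move=> _ _ [v [vw chiv] <-] [v' [v'w chiv'] <-].
    case: (tri v v') => [vv'|vv'|v'v]; first by have [] := IH v' v'w v vv'; tauto.
      by case: chiv'; rewrite -vv'.
    by have [_] := IH v vw v' v'v; apply.
  by exists l => v vw; split=> chiv; [apply: lA|apply: lB]; exists v.
- elim/(well_founded_ind wf): w => w IH eqchi.
  rewrite !cE; congr (@xget {classic L} l0); apply/funext => l; apply/propext.
  have eqc v : lt v w -> c chi v = c chi' v.
    by move=> vw; apply: IH => // u uv; apply: eqchi; apply: trans vw.
  split=> H v vw; have := H v vw; rewrite eqc //; have := eqchi v vw; tauto.
Qed.

(** * Interpolation for growth functions modulo an ultrafilter *)

Section Domination.
Variables (U : set_system nat).
Hypotheses (UU : UltraFilter U) (Ucof : forall n, U [set k | (n <= k)%N]).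

Definition dominated (f g : nat -> nat) : Prop :=
  forall C, U [set k | (f k + C < g k)%N].

Lemma dominated_trans f g h : dominated f g -> dominated g h -> dominated f h.
Proof.
by move=> fg gh C; apply: filterS2 (fg C) (gh 0%N) => k /=; lia.
Qed.

(** A diagonal argument: at [k], only the first [mk k + 1] functions on each side are taken into
    account, where [mk k] is the largest [m <= k] at which they are far enough apart. Since [mk]
    tends to infinity along [U], every [a i] and [b j] is eventually respected, with unbounded
    margin. *)
Lemma dominated_seq_interpolation (a b : nat -> nat -> nat) :
  (forall i j, dominated (a i) (b j)) -> (forall k, a 0%N k <= b 0%N k)%N ->
  exists2 c : nat -> nat, forall k, (a 0%N k <= c k <= b 0%N k)%N &
    forall i, dominated (a i) c /\ dominated c (b i).
Proof.
move=> ab ab0.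
(* The gap [m.*2] is shared equally: [m] between the [a i] and [c], and [m] between [c] and the
   [b j]. *)
pose E m k := [forall i : 'I_m.+1, forall j : 'I_m.+1, (a i k + m.*2 <= b j k)%N].
have EU m : U [set k | E m k].
  have H n n' : U [set k | forall i j, (i < n)%N -> (j < n')%N -> (a i k + m.*2 <= b j k)%N].
    elim: n => [|n IH]; first by apply: filterS filterT => k _ i j; lia.
    have H : U [set k | forall j, (j < n')%N -> (a n k + m.*2 <= b j k)%N].
      elim: n' {IH} => [|n' IH]; first by apply: filterS filterT => k _ j; lia.
      apply: filterS2 IH (ab n n' m.*2) => k /= H1 H2 j.
      by rewrite ltnS leq_eqVlt => /predU1P[->|/H1//]; exact: ltnW.
    apply: filterS2 IH H => k /= H1 H2 i j.
    by rewrite ltnS leq_eqVlt => /predU1P[->|/H1//]; [exact: H2|apply].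
  by apply: filterS (H m.+1 m.+1) => k /= H1; apply/forallP=> i; apply/forallP=> j; exact: H1.
pose mk k := \max_(m < k.+1 | E m k) m.
have mk_ge m k : (m <= k)%N -> E m k -> (m <= mk k)%N.
  rewrite -ltnS => ltmk Emk; exact: (bigmax_sup (Ordinal ltmk)).
have Emk k : (0 < mk k)%N -> E (mk k) k.
  rewrite /mk; elim/big_ind: _ => // x y Hx Hy.
  by rewrite /maxn; case: ifP.
pose c k := (\max_(i < (mk k).+1) a i k + mk k)%N.
have ac i k : (i <= mk k)%N -> (a i k + mk k <= c k)%N.
  by rewrite -ltnS => lei; rewrite leq_add2r (leq_bigmax (Ordinal lei)).
have cb j k : (0 < mk k)%N -> (j <= mk k)%N -> (c k + mk k <= b j k)%N.
  move=> mk_gt0 lej; rewrite /c -addnA addnn.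
  have [i0 _ ->] : {i0 : 'I_(mk k).+1 | true & \max_(i < (mk k).+1) a i k = a i0 k}.
    have ne : (0 < #|'I_(mk k).+1|)%N by rewrite card_ord.
    by have [i0 e] := eq_bigmax (fun i : 'I_(mk k).+1 => a i k) ne; exists i0.
  by have /forallP/(_ i0)/forallP/(_ (Ordinal (lej : j < (mk k).+1)%N)) := Emk k mk_gt0.
have Ulate m : U [set k | (m < mk k)%N].
  by apply: filterS2 (EU m.+1) (Ucof m.+1) => k /= Ek lek; exact: mk_ge.
exists c => [k|i].
  apply/andP; split; first by apply: leq_trans (ac 0%N k _) => //; exact: leq_addr.
  (* When [mk k] is 0, [E 0 k] may fail; then [c k] is [a 0 k], and the pointwise hypothesis gives
     the upper bound. *)
  have [mk0|mk_gt0] := posnP (mk k); last first.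
    by apply: leq_trans (cb 0%N k _ _) => //; exact: leq_addr.
  by rewrite /c mk0 big_ord1 addn0.
split=> C; apply: filterS (Ulate (maxn i C)) => k /=; rewrite gtn_max => /andP[lei leC].
  by apply: leq_trans (ac i k _); [rewrite ltn_add2l|exact: ltnW].
by apply: leq_trans (cb i k _ _); [rewrite ltn_add2l|exact: leq_trans lei|exact: ltnW].
Qed.

(** The functions between [a0] and [b0] form a countably saturated order [L], to which the recursion
    on a well-order of type omega_1 applies. *)
Lemma dominated_branching (W : Type) (a0 b0 : nat -> nat) :
  is_aleph1 W -> dominated a0 b0 -> (forall k, a0 k <= b0 k)%N ->
  exists (lt : W -> W -> Prop) (c : set W -> W -> nat -> nat),
  [/\ strict_well_order lt,
      forall chi w, [/\ forall k, (a0 k <= c chi w k <= b0 k)%N,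
        dominated a0 (c chi w) & dominated (c chi w) b0],
      forall (chi : set W) v w, lt v w ->
        (chi v -> dominated (c chi v) (c chi w)) /\
        (~ chi v -> dominated (c chi w) (c chi v)) &
      forall chi chi' w, (forall v, lt v w -> chi v <-> chi' v) ->
        c chi w = c chi' w].
Proof.
move=> W1 ab leab; have [lt swo cnt] := aleph1_well_order W1.
pose between f := [/\ forall k, (a0 k <= f k <= b0 k)%N,
  dominated a0 f & dominated f b0].
pose L := {f | between f}.
have sat (A B : set L) : countable A -> countable B ->
    (forall a b, A a -> B b -> dominated (sval a) (sval b)) ->
    exists c : L, (forall a, A a -> dominated (sval a) (sval c)) /\
                  (forall b, B b -> dominated (sval c) (sval b)).
  move=> /countable_injP[eA injA] /countable_injP[eB injB] AB.
  (* Index 0 carries the bound [d], and index [j.+1] the member of code [j], or [d] if there is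
     none. Thus empty and finite families are covered, and the interpolant stays between [a0] and
     [b0]. *)
  pose enum (S : set L) (e : L -> nat) d i : nat -> nat :=
    if i is j.+1 then
      @xget {classic nat -> nat} d [set sval l | l in [set l | S l /\ e l = j]]
    else d.
  have enumP S e d i : enum S e d i = d \/ exists2 l : L, S l & enum S e d i = sval l.
    by case: i => [|i] /=; [left|case: xgetP => [f _ [l [Sl _] <-]|]; [right; exists l|left]].
  have enumE (S : set L) (e : L -> nat) d : {in S &, injective e} ->
      forall l, S l -> enum S e d (e l).+1 = sval l.
    move=> injS l Sl; apply: (@xget_unique {classic nat -> nat}); first by exists l.
    by move=> _ [l' [Sl' e'] <-]; congr sval; apply: injS; rewrite ?inE.
  have [|//|c cab cdom] := @dominated_seq_interpolation (enum A eA a0) (enum B eB b0).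
    move=> i j; have [->|[a Aa ->]] := enumP A eA a0 i;
      have [->|[b Bb ->]] := enumP B eB b0 j => //.
    - by case: (proj2_sig b).
    - by case: (proj2_sig a).
    - exact: AB.
  have bc : between c by have [] := cdom 0%N; split.
  exists (exist _ c bc); split=> [a Aa|b Bb] /=.
    by rewrite -(enumE A eA a0 injA a Aa); case: (cdom (eA a).+1).
  by rewrite -(enumE B eB b0 injB b Bb); case: (cdom (eB b).+1).
have [|c [cord ccoh]] := branching_family swo cnt _ sat.
  by move=> f g h; exact: dominated_trans.
exists lt, (fun chi w => sval (c chi w)); split=> //.
- by move=> chi w; exact: (proj2_sig (c chi w)).
- by move=> chi chi' w /ccoh->.
Qed.
End Domination.

Import Order.TTheory Num.Theory.

Local Open Scope ring_scope.
Local Open Scope quotient_scope.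

(** * Prime ideals of quotients and localizations *)

(** Stated for bare sets, so that a candidate can be examined before it is packed as an [idealr];
    [~ S 1] is properness. *)
Definition ideal_set (R : comNzRingType) (S : set R) : Prop :=
  [/\ S 0, ~ S 1, forall x y, S x -> S y -> S (x + y) &
      forall a x, S x -> S (a * x)].

Definition prime_set (R : comNzRingType) (S : set R) : Prop :=
  ideal_set S /\ forall u v, S (u * v) -> S u \/ S v.

Section IdealSets.
Variable R : comNzRingType.
Implicit Types S T : set R.

Let Sb S : {pred R} := fun x => `[< S x >].

Let SbE S : [set` Sb S] = S.
Proof. by apply/seteqP; split=> x /asboolP. Qed.

Lemma idealr_set (I : idealr R) : ideal_set [set` I].
Proof.
split=> [||x y|a x] /=; [exact: idealr0|by rewrite idealr1|exact: rpredD|exact: idealMr].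
Qed.

Lemma prime_idealr_set (I : prime_idealr R) : prime_set [set` I].
Proof. by split=> [|u v]; [exact: idealr_set|move=> /=; rewrite prime_idealrM => /orP]. Qed.

Let Sb_closed S : ideal_set S -> idealr_closed (Sb S).
Proof.
move=> [S0 S1 SD SM]; split; [exact/asboolP|by apply/negP => /asboolP|].
by move=> a u v /asboolP Su /asboolP Sv; apply/asboolP; apply/SD/Sv/SM.
Qed.

Lemma ideal_set_idealr S : ideal_set S -> exists I : idealr R, [set` I] = S.
Proof.
move=> /Sb_closed clS; pose m := isIdealr.Build R (Sb S) clS.
pose I : idealr R := HB.pack (Sb S) m; exists I; exact: SbE.
Qed.

Lemma prime_set_prime_idealr S : prime_set S ->
  exists I : prime_idealr R, [set` I] = S.
Proof.
move=> [/Sb_closed clS prS]; pose m := isIdealr.Build R (Sb S) clS.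
have pS : prime_idealr_closed (Sb S).
  by move=> u v /asboolP/prS[]?; apply/orP; [left|right]; exact/asboolP.
pose m' := isPrimeIdealrClosed.Build R (Sb S) pS.
pose I : prime_idealr R := HB.pack (Sb S) m m'; exists I; exact: SbE.
Qed.

Lemma SpecP S : Spec R S <-> prime_set S.
Proof.
split=> [[I ->]|/prime_set_prime_idealr[I <-]]; last by exists I.
exact: prime_idealr_set.
Qed.

Lemma ideal_setB S x y : ideal_set S -> S x -> S y -> S (x - y).
Proof. by move=> [_ _ SD SM] Sx Sy; rewrite -mulN1r; apply/SD/SM. Qed.

Lemma prime_setX S x n : prime_set S -> S (x ^+ n) -> S x.
Proof.
move=> [[_ S1 _ _] Spr]; elim: n => [/S1//|n IH].
by rewrite exprS => /Spr[].
Qed.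

Lemma ideal_set_sum S n (f : 'I_n -> R) : ideal_set S -> (forall i, S (f i)) ->
  S (\sum_(i < n) f i).
Proof. by move=> [S0 _ SD _] Sf; elim/big_ind: _. Qed.

(** If [u * v] is in [I] and [u] is not, then [I + (u)] is strictly larger, hence not proper:
    [1 = m + a * u]. Multiplying by [v] puts [v] in [I]. *)
Lemma Max_prime S : Max R S -> prime_set S.
Proof.
move=> [I -> Imax]; have [I0 I1 ID IM] := idealr_set I; split=> // u v /= uv.
apply: contrapT => /not_orP[nu nv].
pose J : set R := [set z | exists2 m, m \in I & exists a, z = m + a * u].
have uJ : J u by exists 0 => //; exists 1; rewrite add0r mul1r.
have [/ideal_set_idealr[J' J'J]|nJ] := pselect (ideal_set J).
  apply: nu; suff JI : [set` J'] = [set` I] by have : [set` I] u by rewrite -JI J'J.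
  by apply: Imax; rewrite J'J => m mI; exists m => //; exists 0; rewrite mul0r addr0.
have [m mI [a e]] : J 1.
  apply: contrapT => nJ1; apply: nJ; split=> //.
  - by exists 0 => //; exists 0; rewrite mul0r addr0.
  - move=> _ _ [m mI [a ->]] [m' m'I [a' ->]]; exists (m + m'); first exact: ID.
    by exists (a + a'); ring.
  - move=> b _ [m mI [a ->]]; exists (b * m); first exact: IM.
    by exists (b * a); ring.
apply: nv; rewrite -[v]mulr1 e.
have -> : v * (m + a * u) = v * m + a * (u * v) by ring.
by apply: ID; exact: IM.
Qed.

End IdealSets.

Section QuotientPrimes.
Variables (R : comNzRingType) (E : idealr R) (S : set R).
Hypotheses (Sid : ideal_set S) (ES : [set` E] `<=` S).

(** Since [S] contains [E], it is a union of classes modulo [E]. *)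
Lemma pi_imageP a : (\pi_{ideal_quot E} @` S) (\pi_{ideal_quot E} a) <-> S a.
Proof.
split=> [[b Sb /eqP]|]; last by exists a.
rewrite -Quotient.idealrBE => /ES baS; rewrite -[a](subKr b).
exact: ideal_setB.
Qed.

Lemma pi_image_prime : prime_set S -> prime_set (\pi_{ideal_quot E} @` S).
Proof.
move=> [[S0 S1 SD SM] Spr]; split; first split.
- by rewrite -[0](rmorph0 \pi_{ideal_quot E}); apply/pi_imageP.
- by rewrite -[1](rmorph1 \pi_{ideal_quot E}) => /pi_imageP.
- by move=> _ _ [a Sa <-] [b Sb <-]; rewrite -rmorphD; apply/pi_imageP; exact: SD.
- move=> b _ [a Sa <-]; rewrite -[b]reprK -rmorphM; apply/pi_imageP; exact: SM.
- move=> u v; rewrite -[u]reprK -[v]reprK -rmorphM => /pi_imageP/Spr[]?.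
    by left; apply/pi_imageP.
  by right; apply/pi_imageP.
Qed.

End QuotientPrimes.

Section LocalizedPrimes.
Variables (R : comNzRingType) (Q : prime_idealr R).
Implicit Types (S : set R) (z : localization Q).

Lemma lfrac_surj z : exists a s, z = lfrac (a, s).
Proof. by exists (repr z).1, (repr z).2; rewrite -surjective_pairing lfracK. Qed.

Lemma lfracDE (a b : R) s t :
  lfrac (a, s) + lfrac (b, t) = lfrac (a * val t + b * val s, ldenM s t) :> localization Q.
Proof. exact: lfracD. Qed.

Lemma lfracME (a b : R) s t :
  lfrac (a, s) * lfrac (b, t) = lfrac (a * b, ldenM s t) :> localization Q.
Proof. exact: lfracM. Qed.

Definition loc_ext S : set (localization Q) :=
  [set z | exists a s, S a /\ z = lfrac (a, s)].

(** Elements outside [Q] are outside [S], so primality cancels both the denominator and the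
    multiplier [u] in the equality of fractions. *)
Lemma loc_extP S a s : prime_set S -> S `<=` [set` Q] ->
  loc_ext S (lfrac (a, s)) <-> S a.
Proof.
move=> [[S0 S1 SD SM] Spr] SQ; split=> [[b [t [Sb /lfracP[u nu /= /eqP]]]]|Sa].
  rewrite mulrBr subr_eq0 => /eqP e.
  have : S (u * (a * val t)) by rewrite e; apply: (SM); rewrite mulrC; exact: SM.
  case/Spr => [/SQ/=|/Spr[//|/SQ/=]]; first by rewrite (negPf nu).
  by rewrite (negPf (valP t)).
by exists a, s.
Qed.

Lemma loc_ext_prime S : prime_set S -> S `<=` [set` Q] -> prime_set (loc_ext S).
Proof.
move=> Sp SQ; have [[S0 S1 SD SM] Spr] := Sp; split; first split.
- by exists 0, (lden1 Q).
- by move=> h; apply: S1; apply/(loc_extP 1 (lden1 Q) Sp SQ).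
- move=> _ _ [a [s [Sa ->]]] [b [t [Sb ->]]]; rewrite lfracDE.
  apply/loc_extP => //; by apply: SD; rewrite mulrC; exact: SM.
- move=> c _ [a [s [Sa ->]]]; have [b [t ->]] := lfrac_surj c.
  by rewrite lfracME; apply/loc_extP => //; exact: SM.
- move=> u v; have [a [s ->]] := lfrac_surj u; have [b [t ->]] := lfrac_surj v.
  rewrite lfracME => /loc_extP h; case: (Spr _ _ (h Sp SQ)) => ?.
    by left; apply/loc_extP.
  by right; apply/loc_extP.
Qed.

End LocalizedPrimes.

Section HeightFromChain.
Variables (R : comNzRingType) (E : idealr R) (T : set R) (Q : prime_idealr {ideal_quot E}).
Hypothesis (QT : [set` Q] = \pi_{ideal_quot E} @` T).

(** Primes between [E] and [T] go to primes of the localized quotient, monotonically and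
    injectively: [S] is recovered as the set of [a] whose fraction with denominator 1 lies in
    [F S]. *)
Lemma ht_ge_quotient (V : Type) (k : set V) (C : set (set R)) c :
  (forall S, C S -> [/\ prime_set S, [set` E] `<=` S & S `<=` T]) ->
  total_on C subset -> C c -> k #<= C `\ c -> ht_ge Q k.
Proof.
move=> CP Ctot Cc kC.
pose F S := @loc_ext _ Q (\pi_{ideal_quot E} @` S).
have piQ S : C S -> \pi_{ideal_quot E} @` S `<=` [set` Q].
  by move=> /CP[_ _ ST]; rewrite QT; exact: image_subset.
have piP S : C S -> prime_set (\pi_{ideal_quot E} @` S).
  by move=> /CP[[]]; intros; exact: pi_image_prime.
have FE S a : C S -> F S (lfrac (\pi_{ideal_quot E} a, lden1 Q)) <-> S a.
  move=> CS; rewrite /F loc_extP; [|exact: piP|exact: piQ].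
  by have [[Sid _] ES _] := CP S CS; exact: pi_imageP.
have Finj : {in C &, injective F}.
  move=> S S'; rewrite !inE => CS CS' FSS'; apply/seteqP.
  by split=> a; [move=> /(FE S a CS)|move=> /(FE S' a CS')];
    rewrite (FSS', esym FSS') => /FE; apply.
exists (F @` C); first split.
- by move=> _ [S CS <-]; apply/SpecP/loc_ext_prime; [exact: piP|exact: piQ].
- have mono S S' : S `<=` S' -> F S `<=` F S'.
    by move=> SS' _ [a [s [Sa ->]]]; exists a, s; split=> //; exact: image_subset Sa.
  move=> _ _ [S CS <-] [S' CS' <-].
  by case: (Ctot S S' CS CS') => /mono; [left|right].
exists (F c); first by exists c.
apply: card_le_trans kC _.
have /card_eqPle[_ le1] : F @` (C `\ c) #= C `\ c.
  by apply: inj_card_eq => S S' /set_mem[CS _] /set_mem[CS' _]; apply: Finj; exact: mem_set.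
apply: card_le_trans le1 _; apply: subset_card_le => _ [S [CS nSc] <-].
split; first by exists S.
by move=> /Finj e; apply: nSc; apply: e; exact: mem_set.
Qed.

End HeightFromChain.

(** * Gauss valuations on power series *)

Lemma psc_mul (R : comNzRingType) (f g : powser R) n :
  psc (f * g) n = \sum_(i < n.+1) psc f i * psc g (n - i).
Proof. by []. Qed.

Lemma psc_psC_mul (R : comNzRingType) c (f : powser R) n : psc (psC c * f) n = c * psc f n.
Proof.
rewrite psc_mul big_ord_recl subn0 big1 ?addr0 // => i _.
by rewrite /= mul0r.
Qed.

(** Let [i] and [j] be the first indices whose coefficients are outside [P]. In the coefficient of
    index [i + j] of the product, every term but one lies in [P]. *)
Lemma ps_ideal_prime (R : comNzRingType) (P : set R) :
  prime_set P -> prime_set (ps_ideal P).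
Proof.
move=> [[P0 P1 PD PM] Ppr]; have Pid : ideal_set P by [].
have firstn f : ~ ps_ideal P f ->
    exists2 i, ~ P (psc f i) & forall j, (j < i)%N -> P (psc f j).
  move=> /existsNP[i ni].
  have ex : exists i, `[< ~ P (psc f i) >] by exists i; exact/asboolP.
  case: (ex_minnP ex) => m /asboolP nm mmin; exists m => // j ltj.
  by apply: contrapT => /asboolP/mmin; rewrite leqNgt ltj.
split; first split.
- by move=> n; rewrite /= if_same.
- by move=> /(_ 0%N).
- by move=> f g fP gP n; apply: PD.
- by move=> f g gP n; rewrite psc_mul; apply: ideal_set_sum => // i; exact: PM.
move=> f g fgP; apply: contrapT => /not_orP[/firstn[i ni mi] /firstn[j nj mj]].
have lei : (i < (i + j).+1)%N by rewrite ltnS leq_addr.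
have := fgP (i + j)%N; rewrite psc_mul (bigD1 (Ordinal lei)) //= addKn => sumP.
have {sumP}: P (psc f i * psc g j); last by case/Ppr.
rewrite -[_ * _](addrK (\sum_(k < (i + j).+1 | k != Ordinal lei) psc f k * psc g (i + j - k))).
apply: ideal_setB => //; elim/big_ind: _ => // k nek.
case: (ltngtP k i) => [ltki|ltik|eki].
- by rewrite mulrC; apply/PM/mi.
- by apply/PM/mj; have := ltn_ord k; lia.
- by case/eqP: nek; exact: val_inj.
Qed.

(* [v 0] is meaningless; every hypothesis and definition excludes it. *)
Section GaussValuation.
Variables (R : comNzRingType) (v : R -> rat).
Hypothesis domR : forall a b : R, a != 0 -> b != 0 -> a * b != 0.
Hypothesis v_ge0 : forall a, a != 0 -> 0 <= v a.
Hypothesis vM : forall a b, a != 0 -> b != 0 -> v (a * b) = v a + v b.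
Hypothesis vD : forall a b, a != 0 -> b != 0 -> a + b != 0 ->
  Num.min (v a) (v b) <= v (a + b).
Implicit Types (a b : R) (f g : powser R) (r c q : rat).

Let vgt q a := a = 0 \/ q < v a.

Let vgtD q a b : vgt q a -> vgt q b -> vgt q (a + b).
Proof.
rewrite /vgt; have [->|a0] := eqVneq a 0; first by rewrite add0r.
have [->|b0] := eqVneq b 0; first by rewrite addr0.
move=> [/eqP|va]; first by rewrite (negPf a0).
move=> [/eqP|vb]; first by rewrite (negPf b0).
have [|ab0] := eqVneq (a + b) 0; [by left|right].
by apply: lt_le_trans (vD a0 b0 ab0); rewrite lt_min va.
Qed.

Let vgtM q a b : vgt q b -> vgt q (a * b).
Proof.
have [->|a0] := eqVneq a 0; first by left; rewrite mul0r.
move=> [->|vb]; first by left; rewrite mulr0.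
have [->|b0] := eqVneq b 0; first by left; rewrite mulr0.
by right; rewrite vM // (lt_le_trans vb) // lerDr v_ge0.
Qed.

(** The inequality [phi_r(f) >= c] for the Gauss valuation, stated coefficientwise without forming
    the minimum; zero coefficients count as having infinite value. *)
Definition gauss_ge r c f :=
  forall i, psc f i = 0 \/ c <= v (psc f i) + r * i%:R.

Lemma gauss_geD r c f g : gauss_ge r c f -> gauss_ge r c g -> gauss_ge r c (f + g).
Proof.
move=> hf hg i /=; case: (hf i) => [->|vf]; first by rewrite add0r.
case: (hg i) => [->|vg]; first by rewrite addr0; right.
have [->|a0] := eqVneq (psc f i) 0; first by rewrite add0r; right.
have [->|b0] := eqVneq (psc g i) 0; first by rewrite addr0; right.
have [|ab0] := eqVneq (psc f i + psc g i) 0; [by left|right].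
rewrite -lerBlDr; apply: le_trans (vD a0 b0 ab0).
by rewrite le_min !lerBlDr vf.
Qed.

Lemma gauss_geM r c f g : 0 <= r -> gauss_ge r c g -> gauss_ge r c (f * g).
Proof.
move=> r0 hg n; rewrite psc_mul.
have : forall i : 'I_n.+1, psc f i * psc g (n - i) = 0 \/
    c - r * n%:R <= v (psc f i * psc g (n - i)).
  move=> i; have [->|a0] := eqVneq (psc f i) 0; first by left; rewrite mul0r.
  have [->|b0] := eqVneq (psc g (n - i)) 0; first by left; rewrite mulr0.
  right; rewrite vM //; case: (hg (n - i)%N) => [/eqP|]; first by rewrite (negPf b0).
  have := v_ge0 a0; have : r * (n - i)%:R <= r * n%:R.
    by rewrite ler_wpM2l // ler_nat leq_subr.
  lra.
elim/big_ind: _ => [||i _ /(_ i)[]]; [by left| |by left|by right; lra].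
move=> x y hx hy h; case: (hx h) => [->|vx]; first by rewrite add0r; exact: hy.
case: (hy h) => [->|vy]; first by rewrite addr0; right.
have [->|a0] := eqVneq x 0; first by rewrite add0r; right.
have [->|b0] := eqVneq y 0; first by rewrite addr0; right.
have [|ab0] := eqVneq (x + y) 0; [by left|right].
rewrite -lerBlDr; apply: le_trans (vD a0 b0 ab0).
by rewrite le_min !lerBlDr vx.
Qed.

(** As [v] is nonnegative and [r] positive, [r * i] alone exceeds [w i1] from some [N] on, so the
    minimum is taken over finitely many indices. The least index attaining it is returned, whence
    the strict inequality before it. *)
Let gauss_min r f i1 : 0 < r -> psc f i1 != 0 ->
  exists i0, [/\ psc f i0 != 0,
    forall i, psc f i != 0 -> v (psc f i0) + r * i0%:R <= v (psc f i) + r * i%:R &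
    forall i, (i < i0)%N -> psc f i != 0 ->
      v (psc f i0) + r * i0%:R < v (psc f i) + r * i%:R].
Proof.
move=> r0 f1; pose w i := v (psc f i) + r * i%:R.
pose N := Num.bound (w i1 / r).
have wN i : (N <= i)%N -> psc f i != 0 -> w i1 < w i.
  move=> leNi fi0; have : w i1 / r < i%:R.
    apply: lt_le_trans (_ : N%:R <= _); last by rewrite ler_nat.
    apply: le_lt_trans (archi_boundP _); rewrite ?ler_norm //.
    by rewrite divr_ge0 ?addr_ge0 ?v_ge0 ?mulr_ge0 // ltW.
  by rewrite ltr_pdivrMr // => lt1; rewrite (lt_le_trans lt1) // mulrC lerDr v_ge0.
have i1N : (i1 < N)%N by rewrite ltnNge; apply/negP => /wN/(_ f1); rewrite ltxx.
have [m fm mmin] : exists2 m, psc f m != 0 & forall i, psc f i != 0 -> w m <= w i.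
  have := @arg_minP _ rat 'I_N (Ordinal i1N) (fun i => psc f i != 0) (fun i => w i) f1.
  case=> m fm mmin; exists m => // i fi.
  have [leNi|ltiN] := leqP N i; last exact: (mmin (Ordinal ltiN)).
  by apply: le_trans (mmin (Ordinal i1N) f1) _; exact/ltW/wN.
have ex : exists i, (psc f i != 0) && (w i <= w m) by exists m; rewrite fm /=.
case: (ex_minnP ex) => i0 /andP[f0 le0] min0; exists i0; split=> // i.
  by move=> fi; apply: le_trans le0 _; exact: mmin.
move=> lti fi; rewrite ltNge; apply/negP => lewi.
by have := min0 i; rewrite fi (le_trans lewi le0) leqNgt lti => /(_ isT).
Qed.

(** This is the multiplicativity of [phi_r]. If [i] and [j] are the least minimizing indices of [f]
    and [g], the coefficient of index [i + j] of the product has the value of its single dominant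
    term; two minima below [c] would then add up to less than [c *+ 2]. *)
Lemma gauss_ge_prime r c f g : 0 < r -> gauss_ge r (c *+ 2) (f * g) ->
  gauss_ge r c f \/ gauss_ge r c g.
Proof.
move=> r0 fg; apply: contrapT => /not_orP[/existsNP[i1 /not_orP[/eqP f1 ltf]]].
move=> /existsNP[j1 /not_orP[/eqP g1 ltg]].
have [i [fi fmin fmin']] := gauss_min r0 f1.
have [j [gj gmin gmin']] := gauss_min r0 g1.
have {ltf}ltf : v (psc f i) + r * i%:R < c.
  by apply: le_lt_trans (fmin _ f1) _; rewrite ltNge; exact/negP.
have {ltg}ltg : v (psc g j) + r * j%:R < c.
  by apply: le_lt_trans (gmin _ g1) _; rewrite ltNge; exact/negP.
pose q := v (psc f i) + v (psc g j).
have lei : (i < (i + j).+1)%N by rewrite ltnS leq_addr.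
(* Every other term has [k < i] or [i + j - k < j], and there the choice of least minimizers makes
   the inequality strict. *)
have rest : vgt q (\sum_(k < (i + j).+1 | k != Ordinal lei) psc f k * psc g (i + j - k)).
  elim/big_ind: _ => [||k nek]; [by left|exact: vgtD|].
  have [->|a0] := eqVneq (psc f k) 0; first by left; rewrite mul0r.
  have [->|b0] := eqVneq (psc g (i + j - k)) 0; first by left; rewrite mulr0.
  right; rewrite vM // /q.
  have e : (r * k%:R + r * (i + j - k)%:R = r * i%:R + r * j%:R :> rat).
    by rewrite -!mulrDr -!natrD subnKC // -ltnS.
  case: (ltngtP k i) => [ltki|ltik|eki].
  - by have := fmin' _ ltki a0; have := gmin _ b0; lra.
  - have ltj : (i + j - k < j)%N by have := ltn_ord k; lia.
    by have := gmin' _ ltj b0; have := fmin _ a0; lra.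
  - by case/eqP: nek; exact: val_inj.
have : ~ vgt q (psc (f * g) (i + j)).
  move=> vfg; suff : vgt q (psc f i * psc g j).
    by case=> [/eqP|]; [rewrite (negPf (domR fi gj))|rewrite vM // ltxx].
  move: vfg; rewrite psc_mul (bigD1 (Ordinal lei)) //= addKn => vfg.
  rewrite -[_ * _](addrK
    (\sum_(k < (i + j).+1 | k != Ordinal lei) psc f k * psc g (i + j - k))).
  by apply: vgtD vfg _; rewrite -mulN1r; exact: vgtM.
apply; case: (fg (i + j)%N) => [->|]; first by left.
rewrite natrD mulrDr mulr2n => h; right; rewrite /q; lra.
Qed.
End GaussValuation.

(* The value group generated by the [t n] is Z[1/p], with [t n] of value p^-n. *)
Section TowerValuation.
Variables (R : comNzRingType) (P : set R) (p : nat) (t : nat -> R).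
Hypothesis domR : forall a b : R, a != 0 -> b != 0 -> a * b != 0.
Hypothesis Ppr : prime_set P.
Hypothesis p_gt1 : (1 < p)%N.
Hypothesis tP : forall n, P (t n).
Hypothesis tS : forall n, t n.+1 ^+ p = t n.
Hypothesis t_neq0 : forall n, t n != 0.
Hypothesis factP : forall d : R, d != 0 -> exists n m u, ~ P u /\ d = t n ^+ m * u.

Let pn0 n : (p%:R ^+ n : rat) != 0.
Proof. by rewrite expf_neq0 // pnatr_eq0 -lt0n ltnW. Qed.

Let pn_gt0 n : (0 < p%:R ^+ n :> rat).
Proof. by rewrite exprn_gt0 // ltr0n ltnW. Qed.

Lemma tower_exp n k : t (n + k) ^+ (p ^ k) = t n.
Proof.
elim: k => [|k IH]; first by rewrite addn0 expn0 expr1.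
by rewrite addnS expnS exprM tS.
Qed.

(** Primality extracts [t (n + m)] from its power [t n], and [t m] is in turn a positive power of
    [t (n + m)]. *)
Lemma prime_set_tower (S : set R) n m : prime_set S -> S (t n) -> S (t m).
Proof.
move=> Spr Stn; have [[_ _ _ SM] _] := Spr.
have Snm : S (t (n + m)).
  by apply: (prime_setX (n := (p ^ m)%N) Spr); rewrite tower_exp.
rewrite -(tower_exp m n) addnC -(prednK (n := p ^ n)) ?expn_gt0 1?ltnW //.
by rewrite exprSr; exact: SM.
Qed.

Let mulI (a x y : R) : a != 0 -> a * x = a * y -> x = y.
Proof.
move=> a0 e; apply/eqP; rewrite -subr_eq0; apply/negPn/negP => /(domR a0).
by rewrite mulrBr e subrr eqxx.
Qed.

Let tX_neq0 n m : t n ^+ m != 0.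
Proof. by elim: m => [|m IH]; rewrite ?oner_neq0 // exprS domR. Qed.

Let PtX n m u : (0 < m)%N -> P (t n ^+ m * u).
Proof.
move=> m0; have [[_ _ _ PM] _] := Ppr.
by rewrite -(prednK m0) exprS -mulrA mulrC; exact: PM.
Qed.

(** Otherwise cancelling [t n ^+ b] would make [w] a multiple of [t n], hence an element of [P]. *)
Let order_le n a b u w : ~ P w -> t n ^+ a * u = t n ^+ b * w -> (a <= b)%N.
Proof.
move=> nw e; rewrite leqNgt; apply/negP => ltba; apply: nw.
move: e; rewrite -(subnK (ltnW ltba)) addnC exprD -mulrA => /(mulI (tX_neq0 n b)) <-.
by apply: PtX; rewrite subn_gt0.
Qed.

Let order_uniq n a b u w : ~ P u -> ~ P w -> t n ^+ a * u = t n ^+ b * w -> a = b.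
Proof.
by move=> nu nw e; apply/eqP; rewrite eqn_leq (order_le nw e) (order_le nu (esym e)).
Qed.

Let value_rel d : set rat :=
  [set q | exists n m u, [/\ ~ P u, d = t n ^+ m * u & q = m%:R / p%:R ^+ n]].

Definition tower_val d : rat := xget 0 (value_rel d).
Notation v := tower_val.

Let scale n k m : (m * p ^ k)%:R / p%:R ^+ (n + k) = m%:R / p%:R ^+ n :> rat.
Proof. by rewrite natrM natrX exprD; field; rewrite !pn0. Qed.

(** Two factorizations, at levels [n] and [n'], are compared at level [n + n'], where the exponent
    is unique. *)
Lemma tower_valE d n m u : ~ P u -> d = t n ^+ m * u -> v d = m%:R / p%:R ^+ n.
Proof.
move=> nu e; apply: xget_unique; first by exists n, m, u.
move=> _ [n' [m' [u' [nu' e' ->]]]].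
rewrite -(scale n' n) -(scale n n') [(n' + n)%N]addnC; congr (_%:R / _).
apply: (@order_uniq (n + n') _ _ u' u) => //.
rewrite mulnC exprM [(n + n')%N]addnC tower_exp -e'.
by rewrite mulnC exprM [(n' + n)%N]addnC tower_exp -e.
Qed.

Lemma tower_fact (d : R) n0 : d != 0 ->
  exists n m u, [/\ (n0 <= n)%N, ~ P u & d = t n ^+ m * u].
Proof.
move=> /factP[n [m [u [nu ->]]]]; exists (n + n0)%N, (p ^ n0 * m)%N, u.
by rewrite leq_addl exprM tower_exp.
Qed.

Lemma tower_fact2 (d d' : R) : d != 0 -> d' != 0 -> exists n m u m' u',
  [/\ ~ P u, ~ P u', d = t n ^+ m * u & d' = t n ^+ m' * u'].
Proof.
move=> /factP[n [m [u [nu e]]]] /(tower_fact n)[n' [m' [u' [len nu' e']]]].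
exists n', (p ^ (n' - n) * m)%N, u, m', u'; split=> //.
by rewrite exprM -{1}(subnKC len) tower_exp.
Qed.

Lemma tower_val_ge0 d : d != 0 -> 0 <= v d.
Proof.
move=> /factP[n [m [u [nu e]]]]; rewrite (tower_valE nu e).
by rewrite divr_ge0 // ltW.
Qed.

Lemma tower_valM a b : a != 0 -> b != 0 -> v (a * b) = v a + v b.
Proof.
move=> a0 b0; have [n [m [u [m' [u' [nu nu' ea eb]]]]]] := tower_fact2 a0 b0.
rewrite (tower_valE nu ea) (tower_valE nu' eb) -mulrDl -natrD.
apply: (@tower_valE _ _ _ (u * u')).
  by move=> Puu; have [_ /(_ _ _ Puu)[]] := Ppr.
by rewrite ea eb exprD; ring.
Qed.

Lemma tower_val_ge d n m : d != 0 -> (exists u, d = t n ^+ m * u) ->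
  m%:R / p%:R ^+ n <= v d.
Proof.
move=> d0 [u e].
have u0 : u != 0 by apply: contraNneq d0; rewrite e => ->; rewrite mulr0.
rewrite e tower_valM // -[leLHS]addr0 lerD ?tower_val_ge0 //.
rewrite (@tower_valE _ n m 1) ?mulr1 //.
by have [[]] := Ppr.
Qed.

Lemma tower_valD a b : a != 0 -> b != 0 -> a + b != 0 ->
  Num.min (v a) (v b) <= v (a + b).
Proof.
move=> a0 b0 ab0; have [n [m [u [m' [u' [nu nu' ea eb]]]]]] := tower_fact2 a0 b0.
rewrite (tower_valE nu ea) (tower_valE nu' eb) ge_min.
have [le|/ltnW le] := leqP m m'; apply/orP; [left|right]; apply: tower_val_ge => //.
  by exists (u + t n ^+ (m' - m) * u'); rewrite ea eb mulrDr mulrA -exprD subnKC.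
by exists (t n ^+ (m - m') * u + u'); rewrite ea eb mulrDr mulrA -exprD subnKC.
Qed.

Lemma tower_val_t n : v (t n) = p%:R ^- n.
Proof.
by rewrite (@tower_valE _ n 1 1) ?mulr1 ?expr1 ?mul1r //; have [[]] := Ppr.
Qed.

Lemma tower_val_unit u : ~ P u -> v u = 0.
Proof.
by move=> nu; rewrite (@tower_valE _ 0 0 u) ?expr0 ?mul0r ?mul1r.
Qed.

(** For [d] in [P] the exponent in its factorization is at least 1. *)
Lemma tower_val_gt d : d != 0 -> P d -> exists n, p%:R ^- n <= v d.
Proof.
move=> d0; have [n [m [u [nu e]]]] := factP d0; rewrite e => Pd; exists n.
rewrite -e (tower_valE nu e) ler_peMl ?invr_ge0 ?(ltW (pn_gt0 _)) //.
rewrite ler1n lt0n; apply/eqP => m0; apply: nu.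
by rewrite m0 expr0 mul1r in Pd.
Qed.

End TowerValuation.

(** * Primes between P D[[Y]] and P[[Y]] *)

Lemma cofinite_ultrafilter : exists U : set_system nat,
  UltraFilter U /\ forall n, U [set k | (n <= k)%N].
Proof.
have [U [UU sub]] := @ultraFilterLemma _ (\oo : set_system nat) _.
by exists U; split=> // n; apply: sub; exists n.
Qed.

Lemma ps_ext_ideal (R : comNzRingType) (P : set R) : ideal_set P ->
  ideal_set (ps_ext P) /\ ps_ext P `<=` ps_ideal P.
Proof.
move=> Pid; have [P0 P1 PD PM] := Pid.
have sub : ps_ext P `<=` ps_ideal P.
  move=> _ [n [a [s [Ps ->]]]] k; elim/big_ind: _ => //.
  - by rewrite /= if_same.
  - by move=> f g fP gP; exact: PD.
  move=> i _; have [c Pc <-] := Ps i.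
  by rewrite mulrC psc_psC_mul mulrC; exact: PM.
split=> //; split.
- by exists 0%N, (fun=> 0), (fun=> 0); split=> [[]//|]; rewrite big_ord0.
- by move=> /sub/(_ 0%N).
- move=> _ _ [m [a [s [Ps ->]]]] [n [b [u [Pu ->]]]].
  exists (m + n)%N,
    (fun i : 'I_(m + n) => match fintype.split i with inl j => a j | inr j => b j end),
    (fun i : 'I_(m + n) => match fintype.split i with inl j => s j | inr j => u j end).
  split; first by move=> i; case: (fintype.split i).
  rewrite big_split_ord; congr (_ + _); apply: eq_bigr => i _.
    by rewrite (unsplitK (inl i)).
  by rewrite (unsplitK (inr i)).
- move=> c _ [n [a [s [Ps ->]]]]; exists n, (fun i => c * a i), s; split=> //.
  by rewrite mulr_sumr; apply: eq_bigr => i _; rewrite mulrA.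
Qed.

Section PrimeChain.
Variables (R : comNzRingType) (P : set R) (p : nat) (t : nat -> R).
Hypothesis domR : forall a b : R, a != 0 -> b != 0 -> a * b != 0.
Hypothesis Ppr : prime_set P.
Hypothesis p_gt1 : (1 < p)%N.
Hypothesis tP : forall n, P (t n).
Hypothesis tS : forall n, t n.+1 ^+ p = t n.
Hypothesis t_neq0 : forall n, t n != 0.
Hypothesis factP : forall d : R, d != 0 -> exists n m u, ~ P u /\ d = t n ^+ m * u.
Variable U : set_system nat.
Hypotheses (UU : UltraFilter U) (Ucof : forall n, U [set k | (n <= k)%N]).

Local Notation v := (tower_val P p t).
Local Notation e n := (p%:R ^- n : rat).
Local Notation r k := (e (k.+1 ^ 3)).

Let e_gt0 n : 0 < e n.
Proof. by rewrite invr_gt0 exprn_gt0 // ltr0n ltnW. Qed.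

Let e_le m n : (n <= m)%N -> e m <= e n.
Proof.
move=> le; rewrite lef_pV2 ?posrE ?exprn_gt0 ?ltr0n 1?ltnW //.
by rewrite -!natrX ler_nat leq_pexp2l // ltnW.
Qed.

Let e_le1 n : e n <= 1.
Proof. by have := @e_le n 0 isT; rewrite expr0 invr1. Qed.

Let e_double m n : (n < m)%N -> e m *+ 2 <= e n.
Proof.
move=> lt; apply: le_trans (_ : e n.+1 *+ 2 <= _); first by rewrite lerMn2r e_le.
rewrite exprSr invfM -[leLHS]mulr_natr -mulrA ler_piMr ?(ltW (e_gt0 n)) //.
by rewrite ler_pdivrMl ?mulr1 ?ler_nat // ltr0n ltnW.
Qed.

Let v_ge0 := tower_val_ge0 domR Ppr p_gt1 tP tS t_neq0 factP.
Let vM := tower_valM domR Ppr p_gt1 tP tS t_neq0 factP.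
Let vD := tower_valD domR Ppr p_gt1 tP tS t_neq0 factP.
Let v_t := tower_val_t domR Ppr p_gt1 tP tS t_neq0.
Let v_unit := tower_val_unit domR Ppr p_gt1 tP tS t_neq0.
Let v_gt := tower_val_gt domR Ppr p_gt1 tP tS t_neq0 factP.

(** The free constant [C] absorbs bounded shifts of the exponent, so that a factor 2 lost when
    splitting a product is harmless. *)
Definition growth_ideal (n : nat -> nat) : set (powser R) :=
  [set f | exists C, U [set k | gauss_ge v (r k) (e (n k + C)) f]].

Definition growth_union (N : set (nat -> nat)) : set (powser R) :=
  \bigcup_(n in N) growth_ideal n.

Let gauss_le q c c' f : c' <= c -> gauss_ge v q c f -> gauss_ge v q c' f.
Proof. by move=> le h i; case: (h i) => [|h']; [left|right; apply: le_trans h']. Qed.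

Lemma growth_ideal_mono n n' : dominated U n n' -> growth_ideal n `<=` growth_ideal n'.
Proof.
move=> dom f [C fC]; exists C; apply: filterS2 fC (dom 0%N) => k /= h lt.
by apply: gauss_le h; apply: e_le; lia.
Qed.

(** A coefficient of index [i] outside [P] has value 0, which forces [p^-(n(k)+C) <= r_k i]. But
    [n(k) + C + i < (k+1)^2 <= (k+1)^3] for some [k], and [i < p^i], a contradiction. *)
Lemma growth_ideal_sub n : dominated U n (fun k => k.+1 ^ 2)%N ->
  growth_ideal n `<=` ps_ideal P.
Proof.
move=> dom f [C fC] i; apply: contrapT => nP.
have [k [/(_ i) fk lt]] := filter_ex (filterI fC (dom (C + i)%N)).
case: fk => [fi0|]; first by apply: nP; rewrite fi0; have [[]] := Ppr.
rewrite (v_unit nP) add0r => le.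
suff : r k * i%:R < e (n k + C) by rewrite ltNge le.
apply: le_lt_trans (_ : e (n k + C + i) * i%:R < _).
  rewrite ler_wpM2r // e_le // -addnA.
  by apply: leq_trans (ltnW lt) _; rewrite leq_pexp2l.
have pi0 : (p%:R ^+ i : rat) != 0 by rewrite expf_neq0 // pnatr_eq0 -lt0n ltnW.
rewrite exprD invfM -mulrA gtr_pMr // mulrC ltr_pdivrMr ?mul1r.
  by rewrite -natrX ltr_nat ltn_expl.
by rewrite exprn_gt0 // ltr0n ltnW.
Qed.

(** Comparability of the indices puts two summands in one growth ideal. For a product with constant
    [C], Gauss primality with [C.+1] gives, for almost every [k], the bound on one of the factors;
    the ultrafilter picks the same factor for almost all [k]. *)
Lemma growth_union_prime (N : set (nat -> nat)) :
  N !=set0 -> (forall n n', N n -> N n' -> n = n' \/ dominated U n n' \/ dominated U n' n) ->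
  (forall n, N n -> dominated U n (fun k => k.+1 ^ 2)%N) ->
  prime_set (growth_union N).
Proof.
move=> [n0 Nn0] Ntot Nb.
have sub f : growth_union N f -> ps_ideal P f.
  by move=> [n Nn]; apply: growth_ideal_sub; exact: Nb.
have Pps := ps_ideal_prime Ppr.
split; first split.
- exists n0 => //; exists 0%N; apply: filterS filterT => k _ i; left; exact: if_same.
- by move=> /sub; have [[]] := Pps.
- move=> f g [n Nn fn] [n' Nn' gn'].
  have [m Nm [[C fC] [C' gC']]] : exists2 m, N m & growth_ideal m f /\ growth_ideal m g.
    case: (Ntot n n' Nn Nn') => [e|[dom|dom]].
    - by exists n => //; rewrite {2}e.
    - by exists n' => //; split=> //; apply: growth_ideal_mono fn.
    - by exists n => //; split=> //; apply: growth_ideal_mono gn'.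
  exists m => //; exists (C + C')%N; apply: filterS2 fC gC' => k /= hf hg.
  by apply: gauss_geD => //; [apply: gauss_le hf|apply: gauss_le hg]; apply: e_le; lia.
- move=> f g [n Nn [C gC]]; exists n => //; exists C; apply: filterS gC => k.
  by apply: gauss_geM => //; exact: ltW.
move=> f g [n Nn [C fgC]].
have : U ([set k | gauss_ge v (r k) (e (n k + C.+1)) f] `|`
          [set k | gauss_ge v (r k) (e (n k + C.+1)) g]).
  apply: filterS fgC => k /= fg; apply: gauss_ge_prime => //.
  by apply: gauss_le fg; apply: e_double; rewrite addnS.
have [Uf _|Unf] := in_ultra_setVsetC [set k | gauss_ge v (r k) (e (n k + C.+1)) f] UU.
  by left; exists n => //; exists C.+1.
move=> Ufg; right; exists n => //; exists C.+1.
by apply: filterS2 Unf Ufg => k /= nf [].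
Qed.

(** The Gauss value of a constant series does not depend on [k], so a lower bound [p^-m] for [v a]
    provides the constant [C]. *)
Lemma growth_union_psC (N : set (nat -> nat)) a : N !=set0 -> P a ->
  growth_union N (psC a).
Proof.
move=> [n Nn] Pa; exists n => //.
have [->|a0] := eqVneq a 0.
  by exists 0%N; apply: filterS filterT => k _ i; left; exact: if_same.
have [m lem] := v_gt a0 Pa; exists m; apply: filterS filterT => k _ [|i]; last by left.
by right; rewrite /= mulr0 addr0; apply: le_trans lem; apply: e_le; exact: leq_addl.
Qed.

(** The series [sum_k t_(c(k)) Y^(p^(k^3))]. Searching [k] up to [i] suffices because
    [k <= p^(k^3)]. *)
Definition sparse (c : nat -> nat) : powser R := PowSer (fun i =>
  if [pick k : 'I_i.+1 | (i == p ^ (k ^ 3))%N] is Some k then t (c k) else 0).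

Lemma psc_sparse c i : psc (sparse c) i = 0 \/
  exists2 k, i = (p ^ (k ^ 3))%N & psc (sparse c) i = t (c k).
Proof. by rewrite /=; case: pickP => [k /eqP ek|]; [right; exists k|left]. Qed.

Lemma psc_sparseE c k : psc (sparse c) (p ^ (k ^ 3)) = t (c k).
Proof.
rewrite /=; case: pickP => [j|nopick].
  rewrite eqn_exp2l // eqn_exp2r // => /eqP ekj; by congr (t (c _)).
have lek : (k < (p ^ (k ^ 3)).+1)%N.
  rewrite ltnS (leq_trans _ (ltnW (ltn_expl _ p_gt1))) //.
  by case: (k) => // k'; rewrite -{1}[k'.+1]expn1 leq_pexp2l.
by have := nopick (Ordinal lek); rewrite eqxx.
Qed.

Lemma sparse_ideal c : ps_ideal P (sparse c).
Proof.
by move=> i; case: (psc_sparse c i) => [->|[k _ ->]] //; have [[]] := Ppr.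
Qed.

(** For the term of index [p^(j^3)]: if [j < k], then [c j <= (j+1)^2 <= k^2 <= c k]; if [j > k],
    then [r_k p^(j^3) >= 1]. So [C = 0] works for every [k]. *)
Lemma sparse_growth c : (forall k, k ^ 2 <= c k <= k.+1 ^ 2)%N ->
  growth_ideal c (sparse c).
Proof.
move=> cb; exists 0%N; apply: filterS filterT => k _ i; rewrite addn0.
case: (psc_sparse c i) => [->|[j -> ->]]; [by left|right].
rewrite v_t natrX; case: (leqP j k) => [lejk|ltkj].
  apply: le_trans (_ : e (c j) <= _); last by rewrite lerDl mulr_ge0 // ?exprn_ge0 // ltW.
  apply: e_le; move: lejk; rewrite leq_eqVlt => /predU1P[->//|ltjk].
  have /andP[_ h1] := cb j; have /andP[h2 _] := cb k.
  by apply: leq_trans h1 (leq_trans _ h2); rewrite leq_exp2r.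
apply: le_trans (e_le1 _) _.
have le3 : (k.+1 ^ 3 <= j ^ 3)%N by rewrite leq_exp2r.
rewrite -[leLHS]add0r lerD ?(ltW (e_gt0 _)) //.
rewrite ler_pdivlMl ?mulr1; last by rewrite exprn_gt0 // ltr0n ltnW.
by rewrite -!natrX ler_nat leq_pexp2l // ltnW.
Qed.

(** The term of index [p^(k^3)] has Gauss value at most [2 p^-c(k)], because
    [c k <= (k+1)^2 <= (k+1)^3 - k^3]. This is too small as soon as [c k] exceeds [n k] by
    enough. *)
Lemma sparse_not_growth n c : (forall k, c k <= k.+1 ^ 2)%N -> dominated U n c ->
  ~ growth_ideal n (sparse c).
Proof.
move=> cb dom [C fC].
(* The shift [C.+1] leaves one unit of exponent for the factor 2 and one for strictness. *)
have [k [/(_ (p ^ (k ^ 3))%N)]] := filter_ex (filterI fC (dom C.+1)).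
rewrite psc_sparseE => -[/eqP|]; first by rewrite (negPf (t_neq0 _)).
rewrite v_t natrX => le /= lt.
have : e (c k) *+ 2 <= e (c k).-1 by apply: e_double; lia.
have : r k * p%:R ^+ (k ^ 3)%N <= e (c k).
  rewrite mulrC ler_pdivrMr ?exprn_gt0 // ?ltr0n 1?ltnW //.
  rewrite mulrC ler_pdivlMr ?exprn_gt0 // ?ltr0n 1?ltnW //.
  rewrite -exprD -!natrX ler_nat leq_pexp2l 1?ltnW //.
  by have := cb k; rewrite !expnS expn0; nia.
have : e (c k).-1 < e (n k + C).
  have : e (c k).-1 *+ 2 <= e (n k + C) by apply: e_double; lia.
  by have := e_gt0 (c k).-1; lra.
lra.
Qed.

Lemma tower_ps_height (E : idealr (powser R)) (Q : prime_idealr {ideal_quot E}) :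
  [set` E] = ps_ext P -> [set` Q] = \pi_{ideal_quot E} @` ps_ideal P ->
  forall W : Type, is_aleph1 W -> ht_ge Q [set: set W].
Proof.
move=> EP QP W W1.
(* Their difference [2k + 1] is unbounded, and functions between them are exactly those allowed in
   [sparse_growth]. *)
pose a0 k := (k ^ 2)%N; pose b0 k := (k.+1 ^ 2)%N.
have ab : dominated U a0 b0.
  move=> C; apply: filterS (Ucof C) => k /=; rewrite /a0 /b0 !expnS expn0; lia.
have [|lt [c [swo cb cord ccoh]]] := dominated_branching UU Ucof W1 ab.
  by move=> k; rewrite leq_exp2r.
have [wf trans tri] := swo.
(* The base [a0] keeps [N chi] nonempty when [chi] is empty. An index outside [chi] is left out: its
   function dominates all of [N chi]. *)
pose N chi : set (nat -> nat) := a0 |` [set c chi v | v in chi].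
pose S chi := growth_union (N chi).
have Nb chi n : N chi n -> dominated U n b0.
  by move=> [->|[v _ <-]] //; have [] := cb chi v.
have Sprime chi : prime_set (S chi).
  apply: growth_union_prime => // [|| n /Nb//]; first by exists a0; left.
  move=> _ _ [->|[v cv <-]] [->|[v' cv' <-]]; first by left.
  - by have [] := cb chi v'; right; left.
  - by have [] := cb chi v; right; right.
  - case: (tri v v') => [/(cord chi)[/(_ cv)]|->|/(cord chi)[/(_ cv')]]; [|by left|].
      by right; left.
    by right; right.
have Ssub chi : S chi `<=` ps_ideal P.
  by move=> f [n Nn]; exact: growth_ideal_sub (Nb _ _ Nn) _.
(* At the first [w] where [chi] and [chi'] differ, the function [c chi w] is
   common to both, belongs to [N chi] and dominates all of [N chi']. *)
have Scmp chi chi' w : (forall v, lt v w -> chi v <-> chi' v) -> chi w -> ~ chi' w ->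
    S chi' `<=` S chi /\ ~ S chi `<=` S chi'.
  move=> eqchi chiw nchiw.
  have dom n : N chi' n -> dominated U n (c chi w).
    move=> [->|[v cv <-]]; first by have [] := cb chi w.
    rewrite (ccoh _ _ _ eqchi).
    case: (tri v w) => [/(cord chi')[/(_ cv)]//|evw|/(cord chi')[_ /(_ nchiw)]//].
    by case: nchiw; rewrite -evw.
  have [cbw _ _] := cb chi w.
  split=> [f [n Nn fn]|sub].
    by exists (c chi w); [right; exists w|apply: growth_ideal_mono fn => //; exact: dom].
  have [|n /dom ndom] := sub (sparse (c chi w)).
    by exists (c chi w); [right; exists w|exact: sparse_growth].
  by apply: sparse_not_growth => // k; case/andP: (cbw k).
have Sdiff chi chi' : chi <> chi' ->
    (S chi' `<=` S chi /\ ~ S chi `<=` S chi') \/ (S chi `<=` S chi' /\ ~ S chi' `<=` S chi).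
  move=> ne; have [w [nw minw]] : exists w, ~ (chi w <-> chi' w) /\
      forall v, lt v w -> chi v <-> chi' v.
    apply: contrapT => no; apply: ne; apply/funext => w; apply/propext.
    elim/(well_founded_ind wf): w => w IH; apply: contrapT => nw.
    by apply: no; exists w.
  have [cw|ncw] := pselect (chi w).
    by left; apply: Scmp minw _ _ => //; tauto.
  have [cw'|ncw'] := pselect (chi' w); last by exfalso; tauto.
  by right; apply: (Scmp _ _ w) => // v /minw; tauto.
(* [P[[Y]]] is added as the element discounted in the length. It differs from every [S chi], since
   it contains [sparse b0], which no growth ideal of a function dominated by [b0] does. *)
apply: (@ht_ge_quotient _ E (ps_ideal P) Q QP _ _ (range S `|` [set ps_ideal P]) (ps_ideal P)).
- move=> _ [[chi _ <-]|->]; split=> //.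
  + rewrite EP => _ [n [a [s [Ps ->]]]].
    apply: ideal_set_sum => [|i]; first by have [] := Sprime chi.
    have [[_ _ _ SM] _] := Sprime chi; apply: SM; have [d Pd <-] := Ps i.
    by apply: growth_union_psC => //; exists a0; left.
  + exact: ps_ideal_prime.
  + by rewrite EP; have [] := @ps_ext_ideal _ P (proj1 Ppr).
- move=> _ _ [[chi _ <-]|->] [[chi' _ <-]|->].
  + have [->|/Sdiff[[]|[]]] := pselect (chi = chi'); by [left|right].
  + by left; exact: Ssub.
  + by right; exact: Ssub.
  + by left.
- by right.
have /card_eqPle[_ le1] : range S #= [set: set W].
  apply: inj_card_eq => chi chi' _ _ eS; apply: contrapT => /Sdiff.
  by rewrite eS => -[[_]|[_]]; apply.
apply: card_le_trans le1 _; apply: subset_card_le => _ [chi _ <-].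
split; first by left; exists chi.
move=> eS; have : S chi (sparse b0) by rewrite eS; exact: sparse_ideal.
move=> [n /Nb ndom]; exact: sparse_not_growth.
Qed.

End PrimeChain.

(** * The localization at P *)

Section FieldOfFractions.
Variables (R : comNzRingType) (K : fieldType) (j : {rmorphism R -> K}).

(** [K] may be larger than the fraction field of [R], which is therefore cut out as a subfield of
    [K]. *)
Definition frac_pred : {pred K} :=
  fun z => `[< exists a b, j b != 0 /\ z = j a / j b >].

Fact frac_divring : divring_closed frac_pred.
Proof.
split.
- by apply/asboolP; exists 1, 1; rewrite rmorph1 oner_neq0 divr1.
- move=> _ _ /asboolP[a [b [b0 ->]]] /asboolP[c [d [d0 ->]]]; apply/asboolP.
  exists (a * d - c * b), (b * d).
  rewrite rmorphB !rmorphM mulf_neq0 //; split=> //; field; exact/andP.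
- move=> _ _ /asboolP[a [b [b0 ->]]] /asboolP[c [d [d0 ->]]]; apply/asboolP.
  have [c0|c0] := eqVneq (j c) 0.
    by exists 0, 1; rewrite rmorph0 rmorph1 oner_neq0 c0 !(mul0r, invr0, mulr0).
  exists (a * d), (b * c); rewrite !rmorphM mulf_neq0 //; split=> //.
  by field; rewrite c0 b0 d0.
Qed.

HB.instance Definition _ := GRing.isDivringClosed.Build K frac_pred frac_divring.

Record fractions := Fractions { frac_val : K; frac_valP : frac_val \in frac_pred }.

HB.instance Definition _ := [isSub for frac_val].
HB.instance Definition _ := [Choice of fractions by <:].
HB.instance Definition _ := [SubChoice_isSubIntegralDomain of fractions by <:].
HB.instance Definition _ := [SubIntegralDomain_isSubField of fractions by <:].

Lemma localization_fractions (Q : prime_idealr R) : injective j ->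
  exists i : {rmorphism localization Q -> fractions},
    forall a s, frac_val (i (lfrac (a, s))) = j a / j (val s).
Proof.
move=> jinj.
have j0 (s : {s : R | s \notin Q}) : j (val s) != 0.
  by apply/eqP; rewrite -(rmorph0 j) => /jinj s0; have := valP s; rewrite s0 idealr0.
have fP a (s : {s : R | s \notin Q}) : j a / j (val s) \in frac_pred.
  by apply/asboolP; exists a, (val s).
pose i (z : localization Q) : fractions := Fractions (fP (repr z).1 (repr z).2).
have iE a s : frac_val (i (lfrac (a, s))) = j a / j (val s).
  have /lfracP[u nu /=] := lfracK (lfrac (a, s) : localization Q).
  move=> /(congr1 j); rewrite rmorphM rmorph0 => /eqP; rewrite mulf_eq0.
  have /negPf-> : j u != 0 := j0 (exist _ u nu).
  by rewrite rmorphB subr_eq0 !rmorphM /i /= => /eqP e; apply/eqP; rewrite eqr_div ?j0 // e.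
clearbody i.
have iB : zmod_morphism i.
  move=> x y; have [a [s ->]] := lfrac_surj x; have [b [t ->]] := lfrac_surj y.
  apply: val_inj; rewrite [- lfrac _]lfracN lfracDE rmorphB /= !iE /=.
  by rewrite !(rmorphD, rmorphM, rmorphN); field; rewrite (j0 s) (j0 t).
have iM : monoid_morphism i.
  split; first by apply: val_inj; rewrite /= -[1]/(lfrac (1, lden1 Q)) iE /= rmorph1 divr1.
  move=> x y; have [a [s ->]] := lfrac_surj x; have [b [t ->]] := lfrac_surj y.
  apply: val_inj; rewrite lfracME rmorphM /= !iE /=.
  by rewrite !rmorphM; field; rewrite (j0 s) (j0 t).
pose mB := GRing.isZmodMorphism.Build _ _ i iB.
pose mM := GRing.isMonoidMorphism.Build _ _ i iM.
by pose i' : {rmorphism localization Q -> fractions} := HB.pack i mB mM; exists i'.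
Qed.

End FieldOfFractions.

(** A fraction whose numerator is outside [Q] is a unit. *)
Lemma loc_ideal_subset (R : comNzRingType) (Q : prime_idealr R) (J : set (localization Q)) :
  ideal_set J -> forall a s, J (lfrac (a, s)) -> a \in Q.
Proof.
move=> [_ J1 _ JM] a s Ja; apply/negPn/negP => na; apply: J1.
have -> : 1 = lfrac (val s, exist _ a na) * lfrac (a, s) :> localization Q.
  by rewrite lfracME; apply/lfracP; exists 1; rewrite ?idealr1 //=; ring.
exact: JM.
Qed.

Lemma loc_contract_prime (R : comNzRingType) (Q : prime_idealr R) (J : set (localization Q)) :
  prime_set J -> prime_set [set a | J (lfrac (a, lden1 Q))].
Proof.
move=> [[J0 J1 JD JM] Jpr].
have lM a b : lfrac (a * b, lden1 Q) =
    lfrac (a, lden1 Q) * lfrac (b, lden1 Q) :> localization Q.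
  by rewrite lfracME; apply/lfracP; exists 1; rewrite ?idealr1 //=; ring.
split; first split=> //=.
- move=> a b Ja Jb; have -> : lfrac (a + b, lden1 Q) =
      lfrac (a, lden1 Q) + lfrac (b, lden1 Q) :> localization Q; last exact: JD.
  by rewrite lfracDE; apply/lfracP; exists 1; rewrite ?idealr1 //=; ring.
- by move=> a b Jb; rewrite lM; exact: JM.
- by move=> a b /=; rewrite lM => /Jpr.
Qed.

Lemma loc_contractP (R : comNzRingType) (Q : prime_idealr R) (J : set (localization Q)) :
  ideal_set J -> forall a s, J (lfrac (a, s)) <-> J (lfrac (a, lden1 Q)).
Proof.
move=> [_ _ _ JM] a s; split=> h.
  have -> : lfrac (a, lden1 Q) = lfrac (val s, lden1 Q) * lfrac (a, s) :> localization Q.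
    by rewrite lfracME; apply/lfracP; exists 1; rewrite ?idealr1 //=; ring.
  exact: JM.
have -> : lfrac (a, s) = lfrac (1, s) * lfrac (a, lden1 Q) :> localization Q.
  by rewrite lfracME; apply/lfracP; exists 1; rewrite ?idealr1 //=; ring.
exact: JM.
Qed.

(** * Valuation property, rank and nondiscreteness of the localization *)

Section RankOne.
Variables (R : comNzRingType) (K : fieldType) (j : {rmorphism R -> K}).
Variables (Q : prime_idealr R) (p : nat) (t : nat -> R).
Hypothesis jinj : injective j.
Hypothesis p_gt1 : (1 < p)%N.
Hypothesis tQ : forall n, t n \in Q.
Hypothesis tS : forall n, t n.+1 ^+ p = t n.
Hypothesis t_neq0 : forall n, t n != 0.
Hypothesis factP : forall d : R, d != 0 -> exists n m u, u \notin Q /\ d = t n ^+ m * u.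
Hypothesis QP : forall a, a \in Q -> exists n b, a = t n * b.

Local Notation V := (localization Q).
Let i := projT1 (cid (localization_fractions Q jinj)).
Let iE : forall a s, frac_val (i (lfrac (a, s))) = j a / j (val s).
Proof. by rewrite /i; case: cid. Qed.

Let j_eq0 a : (j a == 0) = (a == 0).
Proof. by apply/eqP/eqP => [|->]; [rewrite -(rmorph0 j) => /jinj|exact: rmorph0]. Qed.

Let j0 (s : {s : R | s \notin Q}) : j (val s) != 0.
Proof. by rewrite j_eq0; apply: contraTneq (valP s) => ->; rewrite idealr0. Qed.

Let domR (a b : R) : a != 0 -> b != 0 -> a * b != 0.
Proof. by rewrite -!j_eq0 rmorphM mulf_eq0 negb_or => -> ->. Qed.

Let lfrac_eq0 a s : (lfrac (a, s) == 0 :> V) = (a == 0).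
Proof.
apply/eqP/eqP => [/(congr1 (@frac_val _ _ _ \o i))/=|->].
  rewrite iE rmorph0 => /eqP; rewrite mulf_eq0 invr_eq0 (negPf (j0 s)) orbF j_eq0.
  by move/eqP.
by apply/lfracP; exists 1; rewrite ?idealr1 //=; ring.
Qed.

Let i_inj : injective i.
Proof.
apply: raddf_inj => x; have [a [s ->]] := lfrac_surj x.
move=> /(congr1 val); rewrite /= iE => /eqP.
rewrite mulf_eq0 invr_eq0 (negPf (j0 s)) orbF j_eq0 => /eqP a0.
by apply/eqP; rewrite lfrac_eq0 a0.
Qed.

Let fraction_field : is_fraction_field i.
Proof.
split=> // -[z zP]; have /asboolP[a [b [b0 e]]] := zP.
exists (lfrac (a, lden1 Q)), (lfrac (b, lden1 Q)).
have vE c : frac_val (i (lfrac (c, lden1 Q))) = j c by rewrite iE /= rmorph1 divr1.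
have nz : i (lfrac (b, lden1 Q)) != 0.
  by rewrite (raddf_eq0 _ i_inj) lfrac_eq0 -j_eq0.
split=> //; apply: val_inj; rewrite fmorph_div /=.
by rewrite !vE.
Qed.

Let fact2 (a b : R) : a != 0 -> b != 0 -> exists n m u m' u',
  [/\ u \notin Q, u' \notin Q, a = t n ^+ m * u & b = t n ^+ m' * u'].
Proof.
move=> a0 b0.
have fP d : d != 0 -> exists n m u, ~ [set` Q] u /\ d = t n ^+ m * u.
  by move=> /factP[n [m [u [nu ->]]]]; exists n, m, u; split=> //; exact/negP.
have [n [m [u [m' [u' [nu nu' ea eb]]]]]] := tower_fact2 tS fP a0 b0.
by exists n, m, u, m', u'; split=> //; apply/negP.
Qed.

(** With numerator and denominator factored at a common level, the smaller power of [t n] cancels,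
    leaving [z] or its inverse with a denominator outside [Q]. *)
Let valring : valuation_ring i.
Proof.
have [_ frac] := fraction_field.
move=> z z0; have /asboolP[a [b [b0 e]]] := frac_valP z.
have a0 : a != 0.
  by apply: contraNneq z0 => a0; apply/eqP/val_inj; rewrite /= e a0 rmorph0 mul0r.
rewrite j_eq0 in b0; have [n [m [u [m' [u' [nu nu' ea eb]]]]]] := fact2 a0 b0.
have ju : j u != 0 := j0 (exist _ u nu); have ju' : j u' != 0 := j0 (exist _ u' nu').
have jt k : j (t k) != 0 by rewrite j_eq0.
have [le|/ltnW le] := leqP m m'; [right|left].
  exists (lfrac (t n ^+ (m' - m) * u', exist _ u nu)) => //; apply: val_inj.
  rewrite fmorphV /= iE e ea eb /= -{2}(subnKC le) exprD !(rmorphM, rmorphXn).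
  by field; rewrite ju ju' !expf_neq0.
exists (lfrac (t n ^+ (m - m') * u, exist _ u' nu')) => //; apply: val_inj.
rewrite /= iE e ea eb /= -{2}(subnKC le) exprD !(rmorphM, rmorphXn).
by field; rewrite ju' !expf_neq0.
Qed.

Let maxV : set V := loc_ext [set` Q].

(** The numerator of a nonzero element of [J] is [t n0 ^+ m * u] with [u] a unit of [V], so [J]
    contains [t n0], hence every [t n], hence all multiples of the [t n], which exhaust [Q]. *)
Let spec_V (J : set V) : Spec V J -> J = [set 0] \/ J = maxV.
Proof.
move=> /SpecP Jpr; have [Jid _] := Jpr; have [J0 _ _ _] := Jid.
have [[z [Jz nz]]|none] := pselect (exists z, J z /\ z != 0); last first.
  left; apply/seteqP; split=> [z Jz|_ ->//]; apply/eqP/negPn/negP => nz.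
  by apply: none; exists z.
right; have cP := loc_contract_prime Jpr.
have [cid _] := cP; pose J' : set R := [set a | J (lfrac (a, lden1 Q))].
have Jt n : J' (t n).
  have [a [s ez]] := lfrac_surj z.
  have a0 : a != 0 by rewrite -(lfrac_eq0 a s) -ez.
  have [n0 [m [u [nu ea]]]] := factP a0.
  have Ja : J' a by apply/(loc_contractP Jid a s); rewrite -ez.
  have Jt0 : J' (t n0).
    have [_ /(_ (t n0 ^+ m) u)] := cP.
    rewrite /mkset -ea => /(_ Ja)[|/(loc_ideal_subset Jid)]; first exact: prime_setX.
    by rewrite (negPf nu).
  exact: (prime_set_tower p_gt1 tS n cP Jt0).
apply/seteqP; split=> [y Jy|y [a [s [Qa ->]]]].
  have [a [s ey]] := lfrac_surj y; exists a, s; split=> //.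
  by move: Jy; rewrite ey => /(loc_ideal_subset Jid).
apply/(loc_contractP Jid); have [n [b ->]] := QP Qa.
by have [_ _ _ JM] := cid; rewrite mulrC; exact: (JM b (t n) (Jt n)).
Qed.

Let maxV_neq0 : maxV <> [set 0].
Proof.
move=> e; have : maxV (lfrac (t 0, lden1 Q)).
  by exists (t 0%N), (lden1 Q); split=> //; exact: tQ.
by rewrite e => /eqP; rewrite lfrac_eq0 (negPf (t_neq0 0)).
Qed.

Let dim_ge1 : dim_ge V `I_1.
Proof.
exists [set [set 0]; maxV]; first split.
- move=> _ [->|->]; apply/SpecP; last first.
    by apply: loc_ext_prime => //; exact: prime_idealr_set.
  split; first split=> //=.
  + by move=> /eqP; rewrite oner_eq0.
  + by move=> x y -> ->; rewrite addr0.
  + by move=> a x ->; rewrite mulr0.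
  + move=> u v /(congr1 i); rewrite rmorphM rmorph0 => /eqP.
    by rewrite mulf_eq0 !(raddf_eq0 _ i_inj) => /orP[]/eqP; [left|right].
- have sub : [set 0] `<=` maxV.
    by move=> _ ->; exists 0, (lden1 Q); split=> //; exact: idealr0.
  by move=> J J' [->|->] [->|->]; (try by left); right.
exists [set 0]; first by left.
have /card_eqPle[_ le1] := @card_set1 _ maxV.
apply: card_le_trans le1 _; apply: subset_card_le => _ ->.
by split; [right|exact: maxV_neq0].
Qed.

Let not_dim_ge2 : ~ dim_ge V `I_2.
Proof.
move=> [C [Cspec _] [c Cc le2]].
have [d Cd] : exists d, C `\ c `<=` [set d].
  have [cE|cE] := spec_V (Cspec c Cc); [exists maxV|exists [set 0]];
    by move=> J [/Cspec/spec_V[]->]; rewrite cE => ne; by [|case: ne].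
have := card_le_trans le2 (subset_card_le Cd).
by rewrite (card_le_eqr card_set1) card_le_II.
Qed.

(** The integer [v (s 0)] would be [p^n v (s n)] for every [n], hence 0; but then the inverse of
    [t 0] would lie in [V], although [t 0] is in the maximal ideal. *)
Let nondiscrete : ~ discrete_value_group i.
Proof.
move=> [v [vM _ vR]].
pose s n : fractions j := i (lfrac (t n, lden1 Q)).
have s0 n : s n != 0 by rewrite (raddf_eq0 _ i_inj) lfrac_eq0.
have v1 : v 1 = 0.
  by have := vM 1 1 (oner_neq0 _) (oner_neq0 _); rewrite mul1r; lia.
have vX y k : y != 0 -> v (y ^+ k) = v y *+ k.
  by move=> y0; elim: k => [|k IH]; rewrite ?expr0 // exprS vM ?expf_neq0 // IH mulrS.
have vs0 n : (0 <= v (s n))%R by apply/(vR _ (s0 n)); exists (lfrac (t n, lden1 Q)).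
have sS n : s n = s n.+1 ^+ p.
  by apply: val_inj; rewrite rmorphXn /= !iE /= rmorph1 !divr1 -rmorphXn tS.
have vsn n : v (s 0%N) = v (s n) *+ (p ^ n).
  elim: n => [|n ->]; first by rewrite expn0.
  by rewrite sS vX // expnS mulrnA.
have vt0 : v (s 0%N) != 0.
  apply/eqP => v0; have : (0 <= v (s 0%N)^-1)%R.
    have := vM _ _ (s0 0%N) (invr_neq0 (s0 0%N)).
    by rewrite divff // v1 v0 add0r => <-.
  move=> /(vR _ (invr_neq0 (s0 0%N)))[z _ ez].
  have [[_ max1 _ maxM] _] : prime_set maxV.
    by apply: loc_ext_prime => //; exact: prime_idealr_set.
  apply: max1; have -> : 1 = z * lfrac (t 0%N, lden1 Q).
    by apply: i_inj; rewrite rmorphM rmorph1 ez mulVf.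
  by apply: maxM; exists (t 0%N), (lden1 Q); split=> //; exact: tQ.
(* Divisibility by [p^N] is contradictory because [N < p^N]. *)
pose N := `|v (s 0%N)|%N.
have := vsn N; case: (ltrgtP 0 (v (s N))) (vs0 N) => // [lt0 _|<- _]; last first.
  by rewrite mul0rn => /eqP; rewrite (negPf vt0).
move=> vN; have eN : N = (`|v (s N)| * p ^ N)%N.
  transitivity `|v (s N) *+ p ^ N|%N; first by rewrite -vN.
  by rewrite -mulr_natr abszM natz absz_nat.
have : (0 < `|v (s N)|)%N by rewrite absz_gt0 gt_eqF.
move/(leq_pmull (p ^ N)); rewrite -eN leqNgt => /negP; apply.
exact: ltn_expl.
Qed.

Lemma localization_rank_one : rank_one_nondiscrete_valuation_domain V.
Proof. by exists (fractions j), i; split. Qed.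

End RankOne.

(** * The ring D *)

Section KernelToField.
Variables (R : comNzRingType) (F : fieldType) (phi : {rmorphism R -> F}).

Lemma kernel_prime : prime_set [set d | phi d = 0].
Proof.
split; first split=> /=.
- exact: rmorph0.
- by rewrite rmorph1; apply/eqP/oner_neq0.
- by move=> a b ea eb; rewrite rmorphD ea eb addr0.
- by move=> a b eb; rewrite rmorphM eb mulr0.
by move=> a b /= /eqP; rewrite rmorphM mulf_eq0 => /orP[]/eqP; [left|right].
Qed.

Hypothesis phi_surj : forall c, exists d, phi d = c.

Lemma kernel_maximal : Max R [set d | phi d = 0].
Proof.
have [I IP] := ideal_set_idealr (proj1 kernel_prime).
exists I => // J sub; apply/seteqP; split=> // d Jd /=; apply: contrapT => /eqP d0.
have [e eP] := phi_surj (phi d)^-1.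
have [_ J1 JD JM] := idealr_set J; apply: J1.
rewrite -(subrK (e * d) 1); apply: JD; last exact: JM.
by apply: sub; rewrite /= rmorphB rmorph1 rmorphM eP mulVf // subrr.
Qed.

Lemma kernel_quotient_iso (I : idealr R) : [set` I] = [set d | phi d = 0] ->
  exists f : {rmorphism {ideal_quot I} -> F}, bijective f.
Proof.
move=> IP; have IE d : d \in I -> phi d = 0.
  by move=> dI; have : [set` I] d by []; rewrite IP.
pose f (z : {ideal_quot I}) := phi (repr z).
have fE d : f (\pi_{ideal_quot I} d) = phi d.
  apply/eqP; rewrite -subr_eq0 -rmorphB; apply/eqP/IE.
  by rewrite Quotient.idealrBE; apply/eqP; rewrite reprK.
clearbody f.
have fB : zmod_morphism f.
  by move=> x y; rewrite -[x]reprK -[y]reprK -rmorphB !fE rmorphB.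
have fM : monoid_morphism f.
  split; first by rewrite -(rmorph1 \pi_{ideal_quot I}) fE rmorph1.
  by move=> x y; rewrite -[x]reprK -[y]reprK -rmorphM !fE rmorphM.
pose mB := GRing.isZmodMorphism.Build _ _ f fB.
pose mM := GRing.isMonoidMorphism.Build _ _ f fM.
pose f' : {rmorphism {ideal_quot I} -> F} := HB.pack f mB mM; exists f'.
have gP c := cid (phi_surj c).
exists (fun c => \pi_{ideal_quot I} (projT1 (gP c))).
  move=> z; rewrite -[z]reprK; apply/eqP; rewrite -Quotient.idealrBE.
  have : [set d | phi d = 0] (projT1 (gP (f' (\pi_{ideal_quot I} (repr z)))) - repr z).
    by rewrite /= rmorphB (projT2 (gP _)) fE subrr.
  by rewrite -IP.
by move=> c; rewrite /= fE (projT2 (gP c)).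
Qed.

End KernelToField.

(** * Roots in [F], evaluation on [D], and the maximal ideals of [D] *)

Section Tower.
Variables (p : nat) (F : closedFieldType) (hp : p \in [pchar F]).
Variables (K : fieldType) (iota : {rmorphism F -> K}) (x : root_tower p iota).

Let p_prime : prime p := pcharf_prime hp.
Let p_gt1 : (1 < p)%N := prime_gt1 p_prime.
Let p_gt0 : (0 < p)%N := prime_gt0 p_prime.
Let hpK : p \in [pchar K]. Proof. by rewrite (fmorph_pchar iota). Qed.

Local Notation ev n f := ((map_poly iota f).[x n]).

(** Every [x n] is transcendental, since [x 0] is one of its powers. *)
Let ev_inj n f : ev n f = 0 -> f = 0.
Proof.
move=> evf; apply/eqP/negPn/negP => f0; apply: (xroot_transcendental (r := x)).
have : algebraicOver iota (x n) by exists f => //; exact/rootP.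
elim: n {evf} => // n IH alg; apply: IH; rewrite -xrootS.
suff H k : algebraicOver iota (x n.+1 ^+ k) by [].
by elim: k => [|k IHk]; [exact: algebraic1|rewrite exprS; exact: algebraic_mul].
Qed.

Lemma proot_exp n (a : F) : proot p n a ^+ (p ^ n) = a.
Proof.
rewrite /proot; case: xgetP => [b _ //|/(_ _)no].
have pn0 : (0 < p ^ n)%N by rewrite expn_gt0 p_gt0.
have [b /= e] := @solve_monicpoly F (p ^ n)%N (fun i => if i == 0%N then a else 0) pn0.
exfalso; apply: (no b); rewrite /= e.
case: (p ^ n)%N pn0 => // m _; rewrite big_ord_recl /= big1 ?addr0 ?mulr1 // => i _.
by rewrite mul0r.
Qed.

Let pFr n (L : fieldType) (hL : p \in [pchar L]) (b c : L) :
  (b - c) ^+ (p ^ n) = b ^+ (p ^ n) - c ^+ (p ^ n).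
Proof.
elim: n b c => [|n IH] b c; first by rewrite expn0 !expr1.
by rewrite expnS !exprM -!(pFrobenius_autE hL) pFrobenius_autB_comm ?IH //; exact: mulrC.
Qed.

(** The [p^n]-th power map is additive in characteristic [p], so the difference of two roots is
    nilpotent. *)
Lemma proot_uniq n (a b : F) : b ^+ (p ^ n) = a -> proot p n a = b.
Proof.
move=> e; apply/eqP; rewrite -subr_eq0.
have /eqP := pFr n hp (proot p n a) b.
by rewrite proot_exp e subrr expf_eq0 => /andP[].
Qed.

Lemma prootS n (a : F) : proot p n.+1 a ^+ p = proot p n a.
Proof. by apply/esym/proot_uniq; rewrite -exprM -expnS proot_exp. Qed.

Lemma proot_neq0 n (a : F) : a != 0 -> proot p n a != 0.
Proof. by apply: contra_neq => a0; rewrite -(proot_exp n a) a0 expr0n expn_eq0 gtn_eqF. Qed.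

Local Notation D := (Dring x).

Let DvalB (d d' : D) : Dval (d - d') = Dval d - Dval d'.
Proof. exact: (rmorphB val). Qed.

Let DvalM (d d' : D) : Dval (d * d') = Dval d * Dval d'.
Proof. exact: (rmorphM val). Qed.

Section Evaluation.
Variables (a : F) (a0 : a != 0).

(* Substitution of the root of [a] for [x n]; the value depends neither on [n] nor
   on the representation of the element. *)
Let rel (d : D) (b : F) := exists n f k, Dval d = ev n f / x n ^+ k /\
  b = f.[proot p n a] / proot p n a ^+ k.

(** One level up, [f] becomes [f(X^p)]; both [x] and the roots of [a] are compatible with this
    substitution. *)
Let rel_raise n m f k : (n <= m)%N -> exists g l,
  ev n f / x n ^+ k = ev m g / x m ^+ l /\
  f.[proot p n a] / proot p n a ^+ k = g.[proot p m a] / proot p m a ^+ l.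
Proof.
move/subnK => <-; elim: (m - n)%N => [|e [g [l [-> ->]]]]; first by exists f, k.
exists (g \Po 'X^p), (p * l)%N.
by rewrite map_comp_poly map_polyXn !horner_comp !hornerXn !exprM xrootS prootS.
Qed.

Let rel_common (d d' : D) b b' : rel d b -> rel d' b' -> exists n f k g l,
  [/\ Dval d = ev n f / x n ^+ k, b = f.[proot p n a] / proot p n a ^+ k,
      Dval d' = ev n g / x n ^+ l & b' = g.[proot p n a] / proot p n a ^+ l].
Proof.
move=> [n [f [k [-> ->]]]] [m [g [l [-> ->]]]]; exists (maxn n m).
have [f' [k' [-> ->]]] := rel_raise f k (leq_maxl n m).
have [g' [l' [-> ->]]] := rel_raise g l (leq_maxr n m).
by exists f', k', g', l'.
Qed.

Let xn0 n k : x n ^+ k != 0.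
Proof. by rewrite expf_neq0 // xroot_neq0. Qed.

Let an0 n k : proot p n a ^+ k != 0.
Proof. by rewrite expf_neq0 // proot_neq0. Qed.

(** At a common level the two representations give, after clearing denominators, an identity of
    polynomials by transcendence, which can be evaluated at the root of [a]. *)
Let rel_uniq d b b' : rel d b -> rel d b' -> b = b'.
Proof.
move=> h h'; have [n [f [k [g [l [-> -> + ->]]]]]] := rel_common h h'.
move=> /eqP; rewrite eqr_div // => /eqP e; apply/eqP; rewrite eqr_div //.
have : ev n (f * 'X^l - g * 'X^k) = 0.
  by rewrite rmorphB !rmorphM /= !map_polyXn !hornerE e subrr.
move/ev_inj/(congr1 (fun q => q.[proot p n a])).
by rewrite !hornerE => /eqP; rewrite subr_eq0.
Qed.

Let rel_ex d : exists b, rel d b.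
Proof.
have /asboolP[n [f [k e]]] := Dval_in d.
by exists (f.[proot p n a] / proot p n a ^+ k), n, f, k.
Qed.

Lemma evaluation_morphism : exists phi : {rmorphism D -> F},
  forall d n f k, Dval d = ev n f / x n ^+ k ->
    phi d = f.[proot p n a] / proot p n a ^+ k.
Proof.
pose phi d := projT1 (cid (rel_ex d)).
have phiP d : rel d (phi d) by rewrite /phi; case: cid.
have phiB : zmod_morphism phi.
  move=> d d'; apply: rel_uniq (phiP _) _.
  have [n [f [k [g [l [ed -> ed' ->]]]]]] := rel_common (phiP d) (phiP d').
  exists n, (f * 'X^l - g * 'X^k), (k + l)%N.
  rewrite DvalB ed ed' rmorphB !rmorphM /= !map_polyXn !hornerE !exprD.
  by split; field; rewrite ?xn0 ?an0.
have phiM : monoid_morphism phi.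
  split.
    apply: rel_uniq (phiP _) _; exists 0%N, 1, 0%N.
    by rewrite rmorph1 !hornerC !expr0 !divr1.
  move=> d d'; apply: rel_uniq (phiP _) _.
  have [n [f [k [g [l [ed -> ed' ->]]]]]] := rel_common (phiP d) (phiP d').
  exists n, (f * g), (k + l)%N.
  rewrite DvalM ed ed' !rmorphM /= !hornerM !exprD.
  by split; field; rewrite ?xn0 ?an0.
pose mB := GRing.isZmodMorphism.Build _ _ phi phiB.
pose mM := GRing.isMonoidMorphism.Build _ _ phi phiM.
pose phi' : {rmorphism D -> F} := HB.pack phi mB mM; exists phi' => d n f k e.
by apply: rel_uniq (phiP d) _; exists n, f, k.
Qed.

End Evaluation.

Let D_embedding : exists j : {rmorphism D -> K}, injective j.
Proof. by exists val; exact: val_inj. Qed.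

Let Dring_neq0M (d d' : D) : d != 0 -> d' != 0 -> d * d' != 0.
Proof.
have [j jinj] := D_embedding; have j0 e : (j e == 0) = (e == 0) by exact: raddf_eq0.
by rewrite -!j0 rmorphM mulf_eq0 negb_or => -> ->.
Qed.

Let polyD_in n f k : ev n f / x n ^+ k \in D_pred x.
Proof. by apply/asboolP; exists n, f, k. Qed.

Let polyD n f k : D := MkDring (polyD_in n f k).

Let polyDE (d : D) : exists n f k, d = polyD n f k.
Proof.
have /asboolP[n [f [k e]]] := Dval_in d.
by exists n, f, k; apply: val_inj.
Qed.

Let polyDM n f g : polyD n (f * g) 0 = polyD n f 0 * polyD n g 0.
Proof. by apply: val_inj; rewrite rmorphM /= rmorphM hornerM !expr0 !divr1. Qed.

Let polyD1 n : polyD n 1 0 = 1.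
Proof. by apply: val_inj; rewrite /= rmorph1 hornerC expr0 divr1. Qed.

Let evXsubC n c : ev n ('X - c%:P) = x n - iota c.
Proof. by rewrite rmorphB /= map_polyX map_polyC /= hornerD hornerN hornerX hornerC. Qed.

Section AtPoint.
Variables (a : F) (a0 : a != 0).

Let phi := projT1 (cid (evaluation_morphism a0)).

Let phiE n f k : phi (polyD n f k) = f.[proot p n a] / proot p n a ^+ k.
Proof. by rewrite /phi; case: cid => /= e eP; exact: eP. Qed.

Definition tower_param n : D := polyD n ('X - (proot p n a)%:P) 0.
Local Notation t := tower_param.

Let tE n : Dval (t n) = x n - iota (proot p n a).
Proof. by rewrite /= evXsubC expr0 divr1. Qed.

Lemma tower_paramS n : t n.+1 ^+ p = t n.
Proof.
apply: val_inj; rewrite rmorphXn /= !evXsubC !expr0 !divr1.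
have := pFr 1 hpK (x n.+1) (iota (proot p n.+1 a)).
by rewrite expn1 => ->; rewrite xrootS -rmorphXn prootS.
Qed.

(** A numerator vanishes at the root of [a] exactly when the corresponding linear factor divides it.
    Primality, maximality and the residue field of [P_a] are all read off from the evaluation. *)
Lemma Pideal_kernel : Pideal x a = [set d | phi d = 0].
Proof.
apply/seteqP; split=> d /=.
  move=> [n [_ [f [k ->]] e]].
  have -> : d = polyD n (('X - (proot p n a)%:P) * f) k.
    by apply: val_inj; rewrite e /= rmorphM hornerM evXsubC mulrA.
  by rewrite phiE hornerM hornerXsubC subrr !mul0r.
have [n [f [k ->]]] := polyDE d; rewrite phiE => /eqP.
rewrite mulf_eq0 invr_eq0 expf_eq0 (negPf (proot_neq0 n a0)) andbF orbF.
move=> /factor_theorem[g ->]; exists n, (ev n g / x n ^+ k); first by exists g, k.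
by rewrite /= rmorphM hornerM evXsubC mulrAC mulrC mulrA.
Qed.

Lemma phi_surjective c : exists d, phi d = c.
Proof. by exists (polyD 0 c%:P 0); rewrite phiE hornerC expr0 divr1. Qed.

Lemma tower_param_Pideal n : Pideal x a (t n).
Proof. by rewrite Pideal_kernel /= phiE hornerXsubC subrr mul0r. Qed.

Lemma tower_param_neq0 n : t n != 0.
Proof.
apply/eqP => /(congr1 val); rewrite /= expr0 divr1 => /ev_inj/eqP.
by rewrite polyXsubC_eq0.
Qed.

(** The exponent [m] is the multiplicity of the root in the numerator, so the cofactor does not
    vanish there. *)
Lemma tower_param_factor (d : D) : d != 0 ->
  exists n m u, ~ Pideal x a u /\ d = t n ^+ m * u.
Proof.
have [n [f [k ->]]] := polyDE d => d0.
have f0 : f != 0.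
  apply: contraNneq d0 => ->; apply/eqP/val_inj.
  by rewrite /= rmorph0 horner0 mul0r.
have [m [g]] := multiplicity_XsubC f (proot p n a).
rewrite f0 /= => ng ef; exists n, m, (polyD n g k); split.
  rewrite Pideal_kernel /= phiE => /eqP.
  by rewrite mulf_eq0 invr_eq0 expf_eq0 (negPf (proot_neq0 n a0)) andbF orbF; exact/negP.
apply: val_inj; rewrite rmorphM rmorphXn /= expr0 divr1 ef rmorphM rmorphXn /=.
by rewrite hornerM horner_exp mulrA [_ * ev n g]mulrC.
Qed.

Lemma Pideal_multiple (d : D) : Pideal x a d -> exists n b, d = t n * b.
Proof.
move=> [n [g gD e]]; have gP : g \in D_pred x by apply/asboolP; exists n.
exists n, (MkDring gP); apply: val_inj.
by rewrite rmorphM -tE in e *.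
Qed.

Lemma Pideal_prime : prime_set (Pideal x a).
Proof. by rewrite Pideal_kernel; exact: kernel_prime. Qed.

Lemma Pideal_maximal : Max D (Pideal x a).
Proof. by rewrite Pideal_kernel; exact: kernel_maximal phi_surjective. Qed.

Lemma Pideal_quotient (I : idealr D) : [set` I] = Pideal x a ->
  exists f : {rmorphism {ideal_quot I} -> F}, bijective f.
Proof. rewrite Pideal_kernel; exact: (kernel_quotient_iso phi_surjective). Qed.

Lemma Pideal_rank_one (Q : prime_idealr D) : [set` Q] = Pideal x a ->
  rank_one_nondiscrete_valuation_domain (localization Q).
Proof.
move=> QP; have QE d : d \in Q <-> Pideal x a d by rewrite -QP.
have [j jinj] := D_embedding.
apply: (localization_rank_one jinj p_gt1 (t := t)).
- by move=> n; apply/QE; exact: tower_param_Pideal.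
- exact: tower_paramS.
- exact: tower_param_neq0.
- move=> d /tower_param_factor[n [m [u [nu e]]]]; exists n, m, u; split=> //.
  by apply/negP => /QE.
- by move=> d /QE/Pideal_multiple.
Qed.

Lemma Pideal_height (E : idealr (powser D)) (Q : prime_idealr {ideal_quot E}) :
  [set` E] = ps_ext (Pideal x a) ->
  [set` Q] = \pi_{ideal_quot E} @` ps_ideal (Pideal x a) ->
  forall W : Type, is_aleph1 W -> ht_ge Q [set: set W].
Proof.
have [U [UU Ucof]] := cofinite_ultrafilter.
exact: (tower_ps_height Dring_neq0M Pideal_prime p_gt1 tower_param_Pideal
  tower_paramS tower_param_neq0 tower_param_factor UU Ucof).
Qed.

End AtPoint.

Lemma Max_Pideal (M : set D) : Max D M -> exists2 a, a != 0 & M = Pideal x a.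
Proof.
move=> Mmax; have Mpr := Max_prime Mmax; have [Mid _] := Mpr.
have [_ M1 _ MM] := Mid.
(* Both ideals are maximal, so an inclusion in either direction is an equality. *)
suff [a a0 sub] : exists2 a, a != 0 & (Pideal x a `<=` M \/ M `<=` Pideal x a).
  exists a => //; have [I IP Imax] := Mmax; have [J JP Jmax] := Pideal_maximal a0.
  case: sub => sub; first by rewrite IP; apply: Jmax; rewrite -IP.
  by rewrite JP; apply/esym/Imax; rewrite -JP.
(* A zero [M] is not excluded beforehand; it would be contained in [P_1]. *)
have [none|[d [Md d0]]] : (forall d, M d -> d = 0) \/ exists d, M d /\ d != 0.
  have [?|/existsNP[d /not_implyP[Md /eqP d0]]] := pselect (forall d, M d -> d = 0).
    by left.
  by right; exists d.
  exists 1; first exact: oner_neq0.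
  right=> d /none->; have [[]] := Pideal_prime (oner_neq0 F); by [].
have [n [f [k ed]]] := polyDE d.
have f0 : f != 0.
  apply: contraNneq d0 => f0; rewrite ed f0; apply/eqP/val_inj.
  by rewrite /= rmorph0 horner0 mul0r.
have Mf : M (polyD n f 0).
  have -> : polyD n f 0 = polyD n 'X^k 0 * d; last exact: MM.
  apply: val_inj; rewrite ed rmorphM /= map_polyXn hornerXn expr0 !divr1.
  by rewrite mulrC divfK // expf_neq0 // xroot_neq0.
(* The numerator splits over [F]; nonzero constants are units, so primality selects a linear
   factor. *)
have [b Mb] : exists b, M (polyD n ('X - b%:P) 0).
  have [r er] := closed_field_poly_normal f.
  have c0 : lead_coef f != 0 by rewrite lead_coef_eq0.
  move: Mf; rewrite {}er; move: (lead_coef f) c0 => c c0.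
  elim: r => [|b r IH]; rewrite ?big_nil ?big_cons => Mf.
    case: M1; have -> : 1 = polyD n c^-1%:P 0 * polyD n (c *: 1) 0; last exact: MM.
    by rewrite -polyDM -mul_polyC mulr1 -polyCM mulVf // polyD1.
  move: Mf; rewrite scalerAr polyDM => /Mpr.2[|/IH//].
  by exists b.
(* The root 0 would put the unit [x n] in [M]. *)
have b0 : b != 0.
  apply/eqP => eb; apply: M1.
  have -> : 1 = polyD n 1 1 * polyD n ('X - b%:P) 0; last exact: MM.
  apply: val_inj; rewrite rmorphM /= eb subr0 map_polyX hornerX rmorph1 hornerC.
  by rewrite expr0 expr1 divr1 mul1r mulVf // xroot_neq0.
(* With this [a], the linear factor found is the parameter of level [n]; then all parameters of [a]
   lie in [M]. *)
exists (b ^+ (p ^ n)); first by rewrite expf_neq0.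
have Mt : M (tower_param (b ^+ (p ^ n)) n) by rewrite /tower_param (@proot_uniq n _ b).
left=> e /Pideal_multiple[m [g ->]]; rewrite mulrC; apply: MM.
exact: (prime_set_tower p_gt1 (tower_paramS (b ^+ (p ^ n))) m Mpr Mt).
Qed.

End Tower.

Theorem corollary3p12 (p : nat) (F : closedFieldType) (hp : p \in [pchar F])
    (K : fieldType) (iota : {rmorphism F -> K}) (x : root_tower p iota) :
  [/\ Max (Dring x) = [set Pideal x a | a in [set a : F | a != 0]],
      forall a : F, a != 0 ->
        exists2 Q : prime_idealr (Dring x), [set` Q] = Pideal x a &
          rank_one_nondiscrete_valuation_domain (localization Q),
      forall a : F, a != 0 ->
        exists2 I : idealr (Dring x), [set` I] = Pideal x a &
          exists f : {rmorphism {ideal_quot I} -> F}, bijective f &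
      forall a : F, a != 0 ->
        exists2 E : idealr (powser (Dring x)), [set` E] = ps_ext (Pideal x a) &
        exists2 Q : prime_idealr {ideal_quot E},
          [set` Q] = \pi_{ideal_quot E} @` ps_ideal (Pideal x a) &
          forall W : Type, is_aleph1 W -> ht_ge Q [set: set W]].
Proof.
split=> [|a a0|a a0|a a0].
- apply/seteqP; split=> [M /(Max_Pideal hp)[a a0 ->]|_ [a a0 <-]]; first by exists a.
  exact: Pideal_maximal.
- have [Q QP] := prime_set_prime_idealr (Pideal_prime hp x a0).
  by exists Q => //; exact: (Pideal_rank_one hp a0).
- have [I IP] := ideal_set_idealr (Pideal_prime hp x a0).1.
  by exists I => //; exact: (Pideal_quotient hp a0).
have Ppr := Pideal_prime hp x a0; have [Eid Esub] := ps_ext_ideal Ppr.1.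
have [E EP] := ideal_set_idealr Eid; exists E => //.
have Psp := ps_ideal_prime Ppr.
have Qpr : prime_set (\pi_{ideal_quot E} @` ps_ideal (Pideal x a)).
  by apply: pi_image_prime => //; [exact: Psp.1|rewrite EP].
have [Q QP] := prime_set_prime_idealr Qpr; exists Q => //.
exact: (Pideal_height hp a0 EP QP).
Qed.
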